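(* Let $n\geq 3$ be an integer. Let $P(z,f)=\sum_{i=0}^{s}b_i(z)f^{(i)}(z)$ be a linear differential polynomial in $f$ and its derivatives, whose coefficients $b_0,\dots,b_s$ are rational functions. Let $P_1,P_2,P_3$ be non-zero rational functions and let $\gamma_1,\gamma_2,\gamma_3$ be non-constant polynomials such that $\gamma_1',\gamma_2',\gamma_3'$ are pairwise distinct. If $f$ is a transcendental meromorphic solution of the differential equation $$f^{n}(z)f'(z)+P(z,f)=P_1(z)e^{\gamma_1(z)}+P_2(z)e^{\gamma_2(z)}+P_3(z)e^{\gamma_3(z)}$$ such that $f$ has finitely many poles, then $f$ is of finite order. Moreover, $f$ cannot be represented in the form $f(z)=w(z)e^{t(z)}$, where $w$ is a non-zero rational function and $t$ is a non-constant polynomial.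
   Context: Meromorphic means meromorphic in the complex plane. The order of a meromorphic function $f$ is $\rho(f)=\limsup_{r\to\infty}\frac{\log T(r,f)}{\log r}$, where $T(r,f)$ is the Nevanlinna characteristic; $f$ is of finite order if $\rho(f)<\infty$. *)

(* Defs.v *)
From HB Require Import structures.
From mathcomp Require Import all_boot all_order all_algebra.
From mathcomp Require Import all_classical all_reals all_analysis.
From mathcomp Require Import complex.

Set Implicit Arguments.
Unset Strict Implicit.
Unset Printing Implicit Defensive.

Import Order.TTheory GRing.Theory Num.Theory.
Import numFieldNormedType.Exports.

Local Open Scope ring_scope.
Local Open Scope complex_scope.
Local Open Scope classical_set_scope.

(* Makes the normed-module structure of R[i] over itself inferable from the
   type R[i], so that [derivable f z 1] and [derive1n n f] are the complex notions. *)
HB.instance Definition _ (R : realType) := NormedModule.copy R[i] R[i]^o.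

Section Meromorphic.
Variable R : realType.
Local Notation C := R[i].
Implicit Types (f g b w : C -> C) (z : C) (p q t : {poly C}) (k n : nat)
  (r : R).

Definition cexp z : C :=
  (expR (complex.Re z) * cos (complex.Im z)) +i*
  (expR (complex.Re z) * sin (complex.Im z)).

Definition holomorphic_at f z : Prop := \forall w \near z, derivable f w 1.

Definition pole_of_order f z k : Prop :=
  (0 < k)%N /\
  exists g, [/\ holomorphic_at g z, g z != 0 &
    \forall w \near z^', f w = g w / (w - z) ^+ k].

Definition pole f z : Prop := exists k, pole_of_order f z k.

(* A meromorphic function is a total function whose value at a pole is
   unconstrained and irrelevant; every other singularity is excluded, removable
   ones included. *)
Definition meromorphic f : Prop :=
  forall z, holomorphic_at f z \/ pole f z.

(* For meromorphic f and g, equality as meromorphic functions. *)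
Definition mero_eq f g : Prop :=
  forall z, ~ pole f z -> ~ pole g z -> f z = g z.

(* By coprimality q.[z] = 0 only at the poles of b, where the right-hand side
   is 0 since x / 0 = 0. *)
Definition rational_function b : Prop :=
  exists p q, [/\ q != 0, coprimep p q & forall z, b z = p.[z] / q.[z]].

Definition transcendental f : Prop :=
  ~ exists b, rational_function b /\ mero_eq f b.

Definition lin_diff_poly (s : nat) (b : 'I_s.+1 -> C -> C) f z : C :=
  \sum_(i < s.+1) b i z * derive1n i f z.

Definition pole_mult f z : nat := xget 0%N [set k | pole_of_order f z k].

(* n(r, f): the poles in the closed disc of radius r, with multiplicity. *)
Definition pole_count f r : R :=
  \sum_(z \in [set z : C | Normc.normc z <= r]) ((pole_mult f z)%:R : R).

(* N(r, f) *)
Definition counting_function f r : R :=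
  \int[lebesgue_measure]_(x in `[0, r])
    ((pole_count f x - pole_count f 0) / x)
  + pole_count f 0 * ln r.

(* [ln 0 = 0] in the library, hence logp 0 = 0 as intended. *)
Definition logp (x : R) : R := Num.max 0 (ln x).

(* m(r, f) *)
Definition proximity_function f r : R :=
  (2 * pi)^-1 *
  \int[lebesgue_measure]_(x in `[0, 2 * pi])
    logp (Normc.normc (f (r%:C * cexp (0 +i* x)))).

Definition nevanlinna_char f r : R :=
  proximity_function f r + counting_function f r.

Definition growth_order f : \bar R :=
  limf_esup (fun r => (ln (nevanlinna_char f r) / ln r)%:E) (pinfty_nbhs R).

Definition finite_order f : Prop := (growth_order f < +oo)%E.

End Meromorphic.

(* Main.v *)
Require Import Defs.
From mathcomp Require Import all_boot all_order all_algebra.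
From mathcomp Require Import all_classical all_reals all_analysis.
From mathcomp Require Import complex.
From mathcomp Require Import ring lra.
Import Order.TTheory GRing.Theory Num.Theory.
Import numFieldNormedType.Exports.
Local Open Scope ring_scope.
Local Open Scope complex_scope.
Local Open Scope classical_set_scope.

Set Implicit Arguments.
Unset Strict Implicit.
Unset Printing Implicit Defensive.

(* Finite order. Outside a large disc [f] is holomorphic, and radial integration of the
   equation, with Cauchy estimates for the derivatives in [P(z, f)], gives
   [M(r)^(n+1) <= A(r) + D(r) M(r + d) / d^s] for the maximum modulus [M], where [A] and [D]
   grow at most like [exp (c r^k)]. If [M(r)] exceeded a fixed bound [Y(r)] of this type, then
   [M(r + d) > Y(r)^2] and iterating with [d = 1/2, 1/4, ...] would make [M(r + 1)] infinite.
   Hence [log M(r)] is polynomially bounded, and since [N(r, f) = O(r)] so is [T(r, f)].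

   Cauchy's estimates are obtained without integration: Goursat's bisection is applied to
   trapezoid sums over squares, which are additive under subdivision and vanish on affine
   functions; this gives [|f c| <= 2 max |f|] over an annulus around [c], applied to
   [(z - w) q(z)^N] with [q] the difference quotient of [f] at [w] and [N] tending to infinity.

   Exponential form. Substituting [f = w e^t] turns the equation into a linear relation over the
   rational functions between [e^((n+1)t)], [e^t] and the three [e^gamma_j]. One of the pairwise
   distinct [gamma_j'] differs from both [(n+1)t'] and [t'], so that the coefficient [P_j] of
   that exponential must vanish. *)

(** * Modulus and complex differentiability *)

(** The hypothesis [3 <= n] enters through exponents. Suppose $|f(w)| > Y^{2^k}$ while $|f| \le X =
    Y^{2^{k+1}}$ up to a slightly larger circle. Then $|f(w)|^{n+1} > X^2$, whereas the integrated
    equation bounds it by $X^2$: the linear part brings one factor $X$, and $Y$ is chosen so large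
    that everything else costs at most another. The loss $d^{-s}$ in Cauchy's estimates is only
    geometric in the number of steps, while $X$ grows doubly exponentially.

    Trapezoid sums require no passage to a limit: around a square centred at $c$ the sum of
    $1/(z-c)$ has imaginary part at least 4 at every level of subdivision, a weak substitute for
    $2\pi i$. The price is the factor 2 in the estimate at the centre, which the $N$-th root
    removes.

    For the exponential form, exponents are compared through their derivatives because exponents
    that differ by a constant give proportional exponentials. *)

Section ComplexModulus.
Variable R : realType.
Local Notation C := R[i].
Implicit Types (z w u v : C) (x y r e : R).

Definition cabs (z : C) : R := Normc.normc z.

Lemma cabsE z : cabs z = Num.sqrt (complex.Re z ^+ 2 + complex.Im z ^+ 2).
Proof. by case: z. Qed.

Lemma normc_cabs z : `|z| = (cabs z)%:C.
Proof. by case: z. Qed.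

Lemma cabs_ge0 z : 0 <= cabs z.
Proof. by rewrite cabsE sqrtr_ge0. Qed.

Lemma cabs0 : cabs 0 = 0. Proof. exact: Normc.normc0. Qed.
Lemma cabs1 : cabs 1 = 1. Proof. exact: Normc.normc1. Qed.
Lemma cabsM z w : cabs (z * w) = cabs z * cabs w. Proof. exact: Normc.normcM. Qed.
Lemma cabsV z : cabs z^-1 = (cabs z)^-1. Proof. exact: Normc.normcV. Qed.
Lemma cabs_eq0 z : (cabs z == 0) = (z == 0).
Proof.
by apply/eqP/eqP => [/Normc.eq0_normc|->] //; exact: cabs0.
Qed.
Lemma cabs_gt0 z : (0 < cabs z) = (z != 0).
Proof. by rewrite lt_def cabs_eq0 cabs_ge0 andbT. Qed.
Lemma cabsN z : cabs (- z) = cabs z.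
Proof. by case: z => a b; rewrite /cabs /= !sqrrN. Qed.
Lemma cabsB z w : cabs (z - w) = cabs (w - z).
Proof. by rewrite -cabsN opprB. Qed.
Lemma cabsX z n : cabs (z ^+ n) = cabs z ^+ n.
Proof. by elim: n => [|n IH]; rewrite ?cabs1 // !exprS cabsM IH. Qed.
Lemma cabs_real x : cabs x%:C = `|x|.
Proof. by rewrite /cabs /= expr0n addr0 sqrtr_sqr. Qed.
Lemma cabsi : cabs (0 +i* 1) = 1.
Proof. by rewrite /cabs /= expr0n expr1n add0r sqrtr1. Qed.

Lemma cabsD z w : cabs (z + w) <= cabs z + cabs w.
Proof.
have := ler_normD z w; rewrite !normc_cabs -rmorphD lecR; exact.
Qed.
Lemma cabs_subD z w : cabs (z - w) <= cabs z + cabs w.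
Proof. by rewrite -(cabsN w); exact: cabsD. Qed.
Lemma cabs_tri u z w : cabs (z - w) <= cabs (z - u) + cabs (u - w).
Proof. by rewrite (le_trans _ (cabsD _ _)) // subrKA. Qed.
Lemma cabs_revD z w : cabs z - cabs w <= cabs (z + w).
Proof. by have := cabs_subD (z + w) w; rewrite addrK lerBlDr. Qed.
Lemma cabs_revB z w : cabs z - cabs w <= cabs (z - w).
Proof. by rewrite -(cabsN w); exact: cabs_revD. Qed.

Lemma Re_le_cabs z : `|complex.Re z| <= cabs z.
Proof. by rewrite cabsE -sqrtr_sqr ler_wsqrtr // lerDl sqr_ge0. Qed.
Lemma Im_le_cabs z : `|complex.Im z| <= cabs z.
Proof. by rewrite cabsE -sqrtr_sqr ler_wsqrtr // lerDr sqr_ge0. Qed.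
Lemma cabs_le_ReIm z : cabs z <= `|complex.Re z| + `|complex.Im z|.
Proof.
rewrite {1}[z]complexE (le_trans (cabsD _ _)) // cabsM cabsi mul1r.
by rewrite !cabs_real.
Qed.

Lemma cabs_sum (I : Type) (s : seq I) (F : I -> C) :
  cabs (\sum_(i <- s) F i) <= \sum_(i <- s) cabs (F i).
Proof.
elim/big_ind2: _ => [|x1 x2 y1 y2 h1 h2|i _] //; first by rewrite cabs0.
by rewrite (le_trans (cabsD _ _)) ?lerD.
Qed.

(* Complex differentiability of [f] at [z] with derivative [l], phrased with the
   real-valued modulus instead of the partially ordered norm of [R[i]]. *)
Definition cdiff (f : C -> C) z l := forall e, 0 < e -> exists2 d, 0 < d &
  forall w, cabs (w - z) < d -> cabs (f w - f z - l * (w - z)) <= e * cabs (w - z).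

Definition ccont (f : C -> C) z := forall e, 0 < e -> exists2 d, 0 < d &
  forall w, cabs (w - z) < d -> cabs (f w - f z) <= e.

Lemma cdiff_local f g z l d : 0 < d ->
  (forall w, cabs (w - z) < d -> f w = g w) -> cdiff f z l -> cdiff g z l.
Proof.
move=> d0 fg fz e /fz [d' d'0 H]; exists (Num.min d d').
  by rewrite lt_min d0 d'0.
move=> w; rewrite lt_min => /andP[wd wd'].
by rewrite -!fg ?H // subrr cabs0.
Qed.

Lemma cdiff_lip f z l : cdiff f z l -> exists2 d, 0 < d &
  forall w, cabs (w - z) < d -> cabs (f w - f z) <= (cabs l + 1) * cabs (w - z).
Proof.
move=> /(_ 1 ltr01) [d d0 H]; exists d => // w /H; rewrite mul1r => h.
have := cabsD (f w - f z - l * (w - z)) (l * (w - z)).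
by rewrite subrK cabsM; lra.
Qed.

Lemma cdiff_cont f z l : cdiff f z l -> ccont f z.
Proof.
move=> /cdiff_lip [d d0 H] e e0; have l0 := cabs_ge0 l.
exists (Num.min d (e / (cabs l + 1))); first by rewrite lt_min d0 divr_gt0 //; lra.
move=> w; rewrite lt_min => /andP[/H h]; rewrite ltr_pdivlMr; last lra.
by move=> h2; rewrite (le_trans h) // mulrC ltW.
Qed.

Lemma cdiff_cst c z : cdiff (fun=> c) z 0.
Proof.
move=> e e0; exists 1 => // w _.
by rewrite subrr mul0r subr0 cabs0 mulr_ge0 ?cabs_ge0 ?ltW.
Qed.

Lemma cdiff_id z : cdiff id z 1.
Proof.
move=> e e0; exists 1 => // w _.
by rewrite mul1r subrr cabs0 mulr_ge0 ?cabs_ge0 ?ltW.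
Qed.

Lemma cdiffD f g z l m : cdiff f z l -> cdiff g z m ->
  cdiff (fun w => f w + g w) z (l + m).
Proof.
move=> fz gz e e0; have e2 : 0 < e / 2 by lra.
have [d d0 H] := fz _ e2; have [d' d'0 H'] := gz _ e2.
exists (Num.min d d'); first by rewrite lt_min d0.
move=> w; rewrite lt_min => /andP[/H h /H' h'].
have -> : f w + g w - (f z + g z) - (l + m) * (w - z) =
  (f w - f z - l * (w - z)) + (g w - g z - m * (w - z)) by ring.
by rewrite (le_trans (cabsD _ _)) // [e in leRHS]splitr mulrDl lerD.
Qed.

Lemma cdiffM f g z l m : cdiff f z l -> cdiff g z m ->
  cdiff (fun w => f w * g w) z (l * g z + f z * m).
Proof.
move=> fz gz e e0.
have [d1 d10 H1] := cdiff_lip fz.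
have lge := cabs_ge0 l; have gge := cabs_ge0 (g z); have fge := cabs_ge0 (f z).
set A := cabs l + 1 in H1; have A0 : 0 < A by rewrite /A; lra.
(* Each of the three terms of the product error gets [e / 3]; the added 1 keeps the denominators
   positive when [g z] or [f z] vanishes. *)
have e1 : 0 < e / (3 * (cabs (g z) + 1)) by rewrite divr_gt0 //; lra.
have e2 : 0 < e / (3 * (cabs (f z) + 1)) by rewrite divr_gt0 //; lra.
have e3 : 0 < e / (3 * A) by rewrite divr_gt0 //; lra.
have [d2 d20 H2] := fz _ e1; have [d3 d30 H3] := gz _ e2.
have [d4 d40 H4] := cdiff_cont gz e3.
exists (Num.min (Num.min d1 d2) (Num.min d3 d4)); first by rewrite !lt_min d10 d20 d30.
move=> w; rewrite !lt_min -!andbA => /and4P[/H1 h1 /H2 h2 /H3 h3 /H4 h4].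
have -> : f w * g w - f z * g z - (l * g z + f z * m) * (w - z) =
  (f w - f z - l * (w - z)) * g z + f z * (g w - g z - m * (w - z)) +
  (f w - f z) * (g w - g z) by ring.
have ww := cabs_ge0 (w - z).
rewrite (le_trans (cabsD _ _)) // (le_trans (lerD (cabsD _ _) (lexx _))) //.
rewrite !cabsM.
have a1 : cabs (f w - f z - l * (w - z)) * cabs (g z) <= e / 3 * cabs (w - z).
  apply: le_trans (_ : e / (3 * (cabs (g z) + 1)) * cabs (w - z) * (cabs (g z) + 1) <= _).
    by apply: ler_pM; rewrite ?cabs_ge0 //; lra.
  by rewrite le_eqVlt; apply/orP; left; apply/eqP; field; rewrite gt_eqF //; lra.
have a2 : cabs (f z) * cabs (g w - g z - m * (w - z)) <= e / 3 * cabs (w - z).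
  apply: le_trans (_ : (cabs (f z) + 1) * (e / (3 * (cabs (f z) + 1)) * cabs (w - z)) <= _).
    by apply: ler_pM; rewrite ?cabs_ge0 //; lra.
  by rewrite le_eqVlt; apply/orP; left; apply/eqP; field; rewrite gt_eqF //; lra.
have a3 : cabs (f w - f z) * cabs (g w - g z) <= e / 3 * cabs (w - z).
  apply: le_trans (_ : (A * cabs (w - z)) * (e / (3 * A)) <= _).
    by apply: ler_pM; rewrite ?cabs_ge0.
  by rewrite le_eqVlt; apply/orP; left; apply/eqP; field; rewrite gt_eqF //; lra.
by lra.
Qed.

Lemma cdiffZ c f z l : cdiff f z l -> cdiff (fun w => c * f w) z (c * l).
Proof.
move=> fz; have := cdiffM (cdiff_cst c z) fz.
by rewrite mul0r add0r.
Qed.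

Lemma cdiffB f g z l m : cdiff f z l -> cdiff g z m ->
  cdiff (fun w => f w - g w) z (l - m).
Proof.
move=> fz /(cdiffZ (-1)) gz; have := cdiffD fz gz; rewrite mulN1r.
by apply: cdiff_local ltr01 _ => w _; rewrite mulN1r.
Qed.

Lemma cdiffX f z l n : cdiff f z l ->
  cdiff (fun w => f w ^+ n) z (n%:R * f z ^+ n.-1 * l).
Proof.
move=> fz; elim: n => [|n IH]; first by rewrite !mul0r; exact: cdiff_cst.
have := cdiffM fz IH; rewrite (_ : _ + _ = n.+1%:R * f z ^+ n * l).
  by apply: cdiff_local ltr01 _ => w _; rewrite exprS.
by case: n {IH} => [|n] /=; rewrite ?expr0 ?exprS -?natr1; ring.
Qed.

Lemma cdiff_comp f g z l m : cdiff g z m -> cdiff f (g z) l ->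
  cdiff (fun w => f (g w)) z (l * m).
Proof.
move=> gz fg e e0.
have lge := cabs_ge0 l; have mge := cabs_ge0 m.
have [d1 d10 H1] := cdiff_lip gz.
set A := cabs m + 1 in H1; have A0 : 0 < A by rewrite /A; lra.
have e1 : 0 < e / (2 * A) by rewrite divr_gt0 //; lra.
have e2 : 0 < e / (2 * (cabs l + 1)) by rewrite divr_gt0 //; lra.
have [d2 d20 H2] := fg _ e1; have [d3 d30 H3] := gz _ e2.
exists (Num.min (Num.min d1 (d2 / A)) d3); first by rewrite !lt_min d10 d30 divr_gt0.
move=> w; rewrite !lt_min ltr_pdivlMr // -!andbA => /and3P[/H1 h1 wd /H3 h3].
have /H2 h2 : cabs (g w - g z) < d2 by rewrite (le_lt_trans h1) // mulrC.
have -> : f (g w) - f (g z) - l * m * (w - z) =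
  (f (g w) - f (g z) - l * (g w - g z)) + l * (g w - g z - m * (w - z)) by ring.
have ww := cabs_ge0 (w - z).
rewrite (le_trans (cabsD _ _)) // cabsM.
have a1 : cabs (f (g w) - f (g z) - l * (g w - g z)) <= e / 2 * cabs (w - z).
  apply: le_trans h2 _; apply: le_trans (_ : e / (2 * A) * (A * cabs (w - z)) <= _).
    by rewrite ler_wpM2l // ltW.
  by rewrite le_eqVlt; apply/orP; left; apply/eqP; field; rewrite gt_eqF //; lra.
have a2 : cabs l * cabs (g w - g z - m * (w - z)) <= e / 2 * cabs (w - z).
  apply: le_trans (_ : (cabs l + 1) * (e / (2 * (cabs l + 1)) * cabs (w - z)) <= _).
    by apply: ler_pM; rewrite ?cabs_ge0 //; lra.
  by rewrite le_eqVlt; apply/orP; left; apply/eqP; field; rewrite gt_eqF //; lra.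
by lra.
Qed.

Lemma cdiff_inv z : z != 0 -> cdiff (fun w => w^-1) z (- (z ^+ 2)^-1).
Proof.
move=> z0 e e0; have Z0 : 0 < cabs z by rewrite cabs_gt0.
(* The first bound gives $|w| \ge |z|/2$; with it the second makes the error $|w-z|^2/(|w||z|^2)$ at
   most $e|w-z|$. *)
exists (Num.min (cabs z / 2) (e * cabs z ^+ 3 / 2)).
  by rewrite lt_min !divr_gt0 // mulr_gt0 // exprn_gt0.
move=> w; rewrite lt_min => /andP[w1 w2].
have wz : cabs z / 2 <= cabs w.
  by have := cabs_revB z w; rewrite cabsB; lra.
have w0 : w != 0 by rewrite -cabs_gt0; lra.
have -> : w^-1 - z^-1 - - (z ^+ 2)^-1 * (w - z) = (w - z) ^+ 2 / (w * z ^+ 2).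
  by field; rewrite w0 z0.
rewrite cabsM cabsV cabsX cabsM cabsX expr2 mulrAC ler_wpM2r ?cabs_ge0 //.
rewrite ler_pdivrMr ?mulr_gt0 ?exprn_gt0 ?cabs_gt0 // (le_trans (ltW w2)) //.
rewrite -mulrA ler_pM2l // (_ : _ / 2 = (cabs z / 2) * cabs z ^+ 2); last by rewrite !exprS; ring.
by rewrite ler_wpM2r ?exprn_ge0 ?cabs_ge0.
Qed.

Lemma cdiff_uniq f z l m : cdiff f z l -> cdiff f z m -> l = m.
Proof.
move=> fl fm; apply/eqP; rewrite -subr_eq0 -cabs_eq0; apply/eqP.
apply/eqP; rewrite eq_le cabs_ge0 andbT; apply/ler_addgt0Pl => e e0; rewrite addr0.
have e2 : 0 < e / 2 by lra.
have [d d0 H] := fl _ e2; have [d' d'0 H'] := fm _ e2.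
pose h := Num.min d d' / 2.
have h0 : 0 < h by rewrite divr_gt0 // lt_min d0.
have m0 : 0 < Num.min d d' by rewrite lt_min d0.
have hm : h < Num.min d d' by rewrite /h; lra.
have wz : cabs (z + h%:C - z) = h by rewrite addrC addKr cabs_real gtr0_norm.
have {}/H : cabs (z + h%:C - z) < d by rewrite wz (lt_le_trans hm) // ge_min lexx.
have {}/H' : cabs (z + h%:C - z) < d' by rewrite wz (lt_le_trans hm) // ge_min lexx orbT.
set w := z + _; rewrite wz => h1 h2; rewrite -(ler_pM2r h0) -[h in leLHS]wz -cabsM.
have -> : (l - m) * (w - z) = (f w - f z - m * (w - z)) - (f w - f z - l * (w - z)) by ring.
by apply: (le_trans (cabs_subD _ _)); lra.
Qed.

End ComplexModulus.

(** * Bisection of the unit square *)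

Section Bisection.
Variable R : realType.

Definition half_pow (k : nat) : R := 2^-1 ^+ k.

Lemma half_pow_gt0 k : 0 < half_pow k.
Proof. by rewrite exprn_gt0 // invr_gt0. Qed.

Lemma half_powS k : half_pow k = half_pow k.+1 + half_pow k.+1.
Proof. by rewrite /half_pow exprS; field. Qed.

Lemma half_pow_le k j : (k <= j)%N -> half_pow j <= half_pow k.
Proof.
move=> /subnKC <-; elim: (j - k)%N => [|i IH]; first by rewrite addn0.
by apply: le_trans IH; rewrite addnS [in leRHS]half_powS lerDl ltW // half_pow_gt0.
Qed.

Lemma half_pow_small e : 0 < e -> exists k, half_pow k < e.
Proof.
move=> e0; have [k hk] : exists k : nat, e^-1 < k%:R.
  by exists (Num.Def.archi_bound e^-1); rewrite archi_boundP // invr_ge0 ltW.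
exists k; rewrite /half_pow exprVn -[e]invrK ltf_pV2 ?posrE ?invr_gt0 ?exprn_gt0 //.
apply: lt_trans hk _; rewrite -natrX ltr_nat; exact: ltn_expl.
Qed.

(** Left endpoints increase and right endpoints decrease, so the supremum of the left endpoints lies
    in every interval. *)
Lemma nested_limit (a : nat -> R) :
  (forall k, a k <= a k.+1 /\ a k.+1 <= a k + half_pow k.+1) ->
  exists p, forall k, a k <= p <= a k + half_pow k.
Proof.
move=> ha.
have up k i : a k <= a (k + i)%N.
  elim: i => [|i IH]; first by rewrite addn0.
  by rewrite addnS (le_trans IH) //; case: (ha (k + i)%N).
have dn k i : a (k + i)%N + half_pow (k + i) <= a k + half_pow k.
  elim: i => [|i IH]; first by rewrite addn0.
  rewrite addnS (le_trans _ IH) // [in leRHS]half_powS; case: (ha (k + i)%N) => _.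
  by rewrite addrA lerD2r.
have ub k j : a j <= a k + half_pow k.
  apply: le_trans (up j k) _; rewrite addnC; apply: le_trans _ (dn k j).
  by rewrite lerDl ltW // half_pow_gt0.
exists (sup (range a)) => k; apply/andP; split.
  by apply: ub_le_sup; [exists (a 0%N + half_pow 0) => _ [j _ <-]; exact: ub | exists k].
by apply: ge_sup; [exists (a 0%N), 0%N | move=> _ [j _ <-]; exact: ub].
Qed.

(** A compactness principle: were [P] false on the unit square, it would fail on a nested sequence
    of quarters, which shrink to a point where the local hypothesis is contradicted. It serves
    Goursat's lemma, the mean value inequality and boundedness on annuli. *)
Lemma bisection (P : R -> R -> nat -> Prop) :
  (forall x y k, let h := half_pow k.+1 in
     P x y k.+1 -> P (x + h) y k.+1 -> P x (y + h) k.+1 ->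
     P (x + h) (y + h) k.+1 -> P x y k) ->
  (forall p q, 0 <= p <= 1 -> 0 <= q <= 1 -> exists2 d, 0 < d &
     forall x y k, 0 <= x -> x + half_pow k <= 1 -> 0 <= y -> y + half_pow k <= 1 ->
     x <= p <= x + half_pow k -> y <= q <= y + half_pow k ->
     half_pow k < d -> P x y k) ->
  P 0 0 0%N.
Proof.
move=> sub loc; apply: contrapT => nP0.
pose good (s s' : R * R) k := [/\ ~ P s'.1 s'.2 k.+1,
  s.1 <= s'.1 <= s.1 + half_pow k.+1 & s.2 <= s'.2 <= s.2 + half_pow k.+1].
have step (s : R * R) k : ~ P s.1 s.2 k -> exists s', good s s' k.
  move=> nP; apply: contrapT => ng; apply: nP.
  have hp := half_pow_gt0 k.+1.
  by apply: sub; apply: contrapT => nP; apply: ng;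
    [exists s | exists (s.1 + half_pow k.+1, s.2) | exists (s.1, s.2 + half_pow k.+1)
    | exists (s.1 + half_pow k.+1, s.2 + half_pow k.+1)]; split => //=; lra.
(* The choice covers all pairs, with the failure of [P] as a premise, so that the sequence of
   squares is a plain recursion. *)
have [nxt nxtP] : exists nxt : R * R -> nat -> R * R,
    forall s k, ~ P s.1 s.2 k -> good s (nxt s k) k.
  have := @choice (R * R * nat)%type (R * R)%type
    (fun t s' => ~ P t.1.1 t.1.2 t.2 -> good t.1 s' t.2).
  case=> [[s k]|g gP] /=; last by exists (fun s k => g (s, k)) => s k; apply: gP (s, k).
  have [nP|/contrapT h] := pselect (~ P s.1 s.2 k); last by exists s.
  by have [s' ?] := step s k nP; exists s'.
pose a := fix a k := if k is k'.+1 then nxt (a k') k' else (0, 0) : R * R.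
have aP k : ~ P (a k).1 (a k).2 k.
  by elim: k => [|k IH] //=; case: (nxtP _ _ IH).
have [p hp] := @nested_limit (fun k => (a k).1) (fun k =>
  let: And3 _ h _ := nxtP _ _ (aP k) in andP h).
have [q hq] := @nested_limit (fun k => (a k).2) (fun k =>
  let: And3 _ _ h := nxtP _ _ (aP k) in andP h).
have hx k : [/\ 0 <= (a k).1, (a k).1 + half_pow k <= 1, 0 <= (a k).2 &
   (a k).2 + half_pow k <= 1].
  elim: k => [|k [h1 h2 h3 h4]]; first by rewrite /= /half_pow expr0; split; lra.
  have [_ /= h5 h6] := nxtP _ _ (aP k); rewrite half_powS in h2 h4.
  by split; lra.
have p01 : 0 <= p <= 1 by have := hp 0%N; rewrite /= /half_pow expr0 add0r.
have q01 : 0 <= q <= 1 by have := hq 0%N; rewrite /= /half_pow expr0 add0r.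
have [d d0 dP] := loc p q p01 q01.
have [k hk] := half_pow_small d0.
by apply: (aP k); case: (hx k) => *; apply: dP.
Qed.

End Bisection.

(** * Goursat's lemma for trapezoid sums *)

Section SquareSums.
Variable R : realType.
Local Notation C := R[i].
Implicit Types (z w u v a d c : C) (g : C -> C) (m k : nat).

Local Notation I := (0 +i* 1 : C).

Lemma cabs_nat n : cabs (n%:R : C) = n%:R.
Proof. by rewrite -(rmorph_nat (real_complex R)) cabs_real normr_nat. Qed.

Lemma sqrI : I * I = -1.
Proof. by apply/eqP; rewrite eq_complex /=; apply/andP; split; apply/eqP; ring. Qed.

(* Composite trapezoid sum of [g dz] over the segment from [u] to [u + d], cut
   into [2 ^ m] pieces. *)
Fixpoint trap g m u d : C :=
  if m is m'.+1 then trap g m' u (d / 2) + trap g m' (u + d / 2) (d / 2)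
  else (g u + g (u + d)) / 2 * d.

(** Counterclockwise sum over the boundary of the square with corner [a] and sides [d], [I * d]; the
    top and left sides are traversed backwards, hence the signs. A complex [d] allows the square to
    be turned. *)
Definition square_sum g m a d : C :=
  trap g m a d + trap g m (a + d) (I * d) - trap g m (a + I * d) d
  - trap g m a (I * d).

Lemma eq_trap g g' m u d : g =1 g' -> trap g m u d = trap g' m u d.
Proof.
by move=> gg; elim: m u d => [|m IH] u d /=; rewrite ?gg // !IH.
Qed.

Lemma trapB g g' m u d :
  trap (fun z => g z - g' z) m u d = trap g m u d - trap g' m u d.
Proof. by elim: m u d => [|m IH] u d /=; rewrite ?IH; ring. Qed.

Lemma trapZ x g m u d : trap (fun z => x * g z) m u d = x * trap g m u d.
Proof. by elim: m u d => [|m IH] u d /=; rewrite ?IH; ring. Qed.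

Lemma trap_rev g m u d : trap g m (u + d) (- d) = - trap g m u d.
Proof.
elim: m u d => [|m IH] u d /=; first by rewrite addrK; ring.
rewrite mulNr (_ : u + d = u + d / 2 + d / 2); last by field.
by rewrite IH addrK IH; ring.
Qed.

(** The trapezoid rule is exact on affine functions, so every level gives the increment of the
    antiderivative $xz + yz^2/2$; around a closed contour these increments cancel. *)
Lemma trap_affine x y m u d :
  trap (fun z => x + y * z) m u d = x * d + y * ((u + d) ^+ 2 - u ^+ 2) / 2.
Proof. by elim: m u d => [|m IH] u d /=; rewrite ?IH; field. Qed.

Lemma trap_bound g m u d (B : R) :
  (forall t : R, 0 <= t <= 1 -> cabs (g (u + t%:C * d)) <= B) ->
  cabs (trap g m u d) <= B * cabs d.
Proof.
elim: m u d => [|m IH] u d gB /=.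
  rewrite cabsM ler_wpM2r ?cabs_ge0 // cabsM cabsV.
  rewrite cabs_nat.
  rewrite ler_pdivrMr // (le_trans (cabsD _ _)) //.
  have := gB 0; rewrite mul0r addr0 => /(_ _) h0; have := gB 1; rewrite mul1r => /(_ _) h1.
  by have := h0 ltac:(lra); have := h1 ltac:(lra); lra.
have d2 : cabs (d / 2) = cabs d / 2.
  by rewrite cabsM cabsV cabs_nat.
have h1 : cabs (trap g m u (d / 2)) <= B * cabs (d / 2).
  apply: IH => t t01; have -> : t%:C * (d / 2) = (t / 2)%:C * d.
    by rewrite rmorphM /= fmorphV /= rmorph_nat; field.
  by apply: gB; lra.
have h2 : cabs (trap g m (u + d / 2) (d / 2)) <= B * cabs (d / 2).
  apply: IH => t t01; have -> : u + d / 2 + t%:C * (d / 2) = u + (1 / 2 + t / 2)%:C * d.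
    by rewrite rmorphD !rmorphM /= !fmorphV /= rmorph1 !rmorph_nat; field.
  by apply: gB; lra.
by rewrite (le_trans (cabsD _ _)) //; rewrite d2 in h1 h2; lra.
Qed.

Lemma square_sumB g g' m a d :
  square_sum (fun z => g z - g' z) m a d = square_sum g m a d - square_sum g' m a d.
Proof. by rewrite /square_sum !trapB; ring. Qed.

Lemma square_sumZ x g m a d :
  square_sum (fun z => x * g z) m a d = x * square_sum g m a d.
Proof. by rewrite /square_sum !trapZ; ring. Qed.

Lemma eq_square_sum g g' m a d : g =1 g' -> square_sum g m a d = square_sum g' m a d.
Proof. by move=> gg; rewrite /square_sum !(eq_trap _ _ _ gg). Qed.

Lemma square_sum_affine x y m a d : square_sum (fun z => x + y * z) m a d = 0.
Proof. by rewrite /square_sum !trap_affine; field. Qed.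

(** The interior sides cancel in pairs. The level drops by one because a side cut into $2^{m+1}$
    pieces is two half sides cut into $2^m$, which makes the identity exact. *)
Lemma square_sum_split g m a d : square_sum g m.+1 a d =
  square_sum g m a (d / 2) + square_sum g m (a + d / 2) (d / 2) +
  square_sum g m (a + I * (d / 2)) (d / 2) +
  square_sum g m (a + d / 2 + I * (d / 2)) (d / 2).
Proof.
rewrite /square_sum /=.
have -> : I * d / 2 = I * (d / 2) by ring.
have -> : a + d / 2 + d / 2 = a + d by field.
have -> : a + I * (d / 2) + I * (d / 2) = a + I * d by field.
have -> : a + d / 2 + I * (d / 2) + d / 2 = a + d + I * (d / 2) by field.
have -> : a + d / 2 + I * (d / 2) + I * (d / 2) = a + I * d + d / 2 by field.
have -> : a + I * (d / 2) + d / 2 = a + d / 2 + I * (d / 2) by ring.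
ring.
Qed.

(** The same contour started at the next corner. It allows any corner to serve as base point, as the
    use of [goursat_corner] demands. *)
Lemma square_sum_rot g m a d : square_sum g m (a + d) (I * d) = square_sum g m a d.
Proof.
rewrite /square_sum mulrA sqrI mulN1r addrK.
have -> : a + d + I * d = a + I * d + d by ring.
by rewrite !trap_rev; ring.
Qed.

Definition unit_itv (t : R) := 0 <= t <= 1.

Definition in_square a d z := exists x y : R,
  [/\ unit_itv x, unit_itv y & z = a + d * (x +i* y)].

Definition on_square a d z := exists2 t : R, unit_itv t &
  [\/ z = a + t%:C * d, z = a + d + t%:C * (I * d), z = a + I * d + t%:C * d |
      z = a + t%:C * (I * d)].

Lemma on_in_square a d z : on_square a d z -> in_square a d z.
Proof.
have RI x y : (x +i* y : C) = x%:C + I * y%:C by rewrite [LHS]complexE.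
have u0 : unit_itv 0 by rewrite /unit_itv; lra.
have u1 : unit_itv 1 by rewrite /unit_itv; lra.
by case=> t ht [] ->; [exists t, 0 | exists 1, t | exists t, 1 | exists 0, t];
  split=> //; rewrite RI ?rmorph0 ?rmorph1; ring.
Qed.

Lemma cabs_square x y : unit_itv x -> unit_itv y -> cabs (x +i* y : C) <= 2.
Proof.
rewrite /unit_itv => hx hy; apply: le_trans (cabs_le_ReIm _) _ => /=.
by rewrite !ger0_norm; lra.
Qed.

Lemma in_square_dist a d z w : in_square a d z -> in_square a d w ->
  cabs (z - w) <= 2 * cabs d.
Proof.
move=> [x [y [hx hy ->]]] [x' [y' [hx' hy' ->]]].
have -> : a + d * (x +i* y) - (a + d * (x' +i* y')) = d * ((x - x') +i* (y - y')).
  by rewrite opprD addrACA subrr add0r -mulrBr.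
rewrite cabsM mulrC ler_wpM2r ?cabs_ge0 //; apply: le_trans (cabs_le_ReIm _) _ => /=.
rewrite /unit_itv in hx hy hx' hy'.
have : `|x - x'| <= 1 by rewrite ler_norml; lra.
have : `|y - y'| <= 1 by rewrite ler_norml; lra.
by lra.
Qed.

Lemma square_sum_bound g m a d (B : R) :
  (forall z, on_square a d z -> cabs (g z) <= B) ->
  cabs (square_sum g m a d) <= 4 * B * cabs d.
Proof.
move=> gB; rewrite /square_sum.
have Id : cabs (I * d) = cabs d by rewrite cabsM cabsi mul1r.
have h1 : cabs (trap g m a d) <= B * cabs d.
  by apply: trap_bound => t ht; apply: gB; exists t => //; constructor 1.
have h2 : cabs (trap g m (a + d) (I * d)) <= B * cabs d.
  by rewrite -Id; apply: trap_bound => t ht; apply: gB; exists t => //; constructor 2.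
have h3 : cabs (trap g m (a + I * d) d) <= B * cabs d.
  by apply: trap_bound => t ht; apply: gB; exists t => //; constructor 3.
have h4 : cabs (trap g m a (I * d)) <= B * cabs d.
  by rewrite -Id; apply: trap_bound => t ht; apply: gB; exists t => //; constructor 4.
have := cabs_subD (trap g m a d + trap g m (a + d) (I * d) - trap g m (a + I * d) d)
  (trap g m a (I * d)).
have := cabs_subD (trap g m a d + trap g m (a + d) (I * d)) (trap g m (a + I * d) d).
have := cabsD (trap g m a d) (trap g m (a + d) (I * d)).
by lra.
Qed.

(** Takes the place of a limit in [m]: a bound valid for all sufficiently fine subdivisions. *)
Definition ev_le (F : nat -> C) (e : R) := exists m0, forall m, (m0 <= m)%N ->
  cabs (F m) <= e.

Lemma ev_leW F (e e' : R) : e <= e' -> ev_le F e -> ev_le F e'.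
Proof. by move=> ee [m0 h]; exists m0 => m /h h'; exact: le_trans ee. Qed.

Lemma ev_le_split g a d (e1 e2 e3 e4 : R) :
  ev_le (fun m => square_sum g m a (d / 2)) e1 ->
  ev_le (fun m => square_sum g m (a + d / 2) (d / 2)) e2 ->
  ev_le (fun m => square_sum g m (a + I * (d / 2)) (d / 2)) e3 ->
  ev_le (fun m => square_sum g m (a + d / 2 + I * (d / 2)) (d / 2)) e4 ->
  ev_le (fun m => square_sum g m a d) (e1 + e2 + e3 + e4).
Proof.
move=> [m1 h1] [m2 h2] [m3 h3] [m4 h4].
exists (maxn (maxn m1 m2) (maxn m3 m4)).+1 => -[//|m]; rewrite ltnS !geq_max.
move=> /andP[/andP[/h1 {}h1 /h2 {}h2] /andP[/h3 {}h3 /h4 {}h4]].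
rewrite square_sum_split; do 3! (rewrite (le_trans (cabsD _ _)) // lerD //).
Qed.

(** Granting each subsquare an error proportional to its area makes the bound additive under
    quartering, so only small squares around a given point matter. There the affine part of [g]
    contributes nothing, and the remainder is small compared with the side, hence its sum is small
    compared with the area. *)
Lemma goursat g a d : (forall z, in_square a d z -> exists l, cdiff g z l) ->
  forall e : R, 0 < e -> ev_le (fun m => square_sum g m a d) e.
Proof.
move=> gd e e0.
pose P x y k := ev_le (fun m => square_sum g m (a + d * (x +i* y)) (d * (half_pow R k)%:C))
  (e * half_pow R k ^+ 2).
have : P 0 0 0%N; last first.
  rewrite /P /half_pow expr0 expr1n mulr1 (_ : (0 +i* 0 : C) = 0) //.
  by rewrite mulr0 addr0 rmorph1 mulr1.
have RI x y : (x +i* y : C) = x%:C + I * y%:C by rewrite [LHS]complexE.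
apply: bisection => [x y k h p1 p2 p3 p4|p q hp hq].
- rewrite /P half_powS -/h; have hh : d * (h + h)%:C / 2 = d * h%:C.
    by rewrite rmorphD; field.
  have -> : e * (h + h) ^+ 2 = e * h ^+ 2 + e * h ^+ 2 + e * h ^+ 2 + e * h ^+ 2 by ring.
  apply: ev_le_split; rewrite hh //.
  + have -> : a + d * (x +i* y) + d * h%:C = a + d * ((x + h) +i* y).
      by rewrite (RI x) (RI (x + h)) rmorphD /=; ring.
    exact: p2.
  + have -> : a + d * (x +i* y) + I * (d * h%:C) = a + d * (x +i* (y + h)).
      by rewrite (RI x y) (RI x (y + h)) rmorphD /=; ring.
    exact: p3.
  + have -> : a + d * (x +i* y) + d * h%:C + I * (d * h%:C) = a + d * ((x + h) +i* (y + h)).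
      by rewrite (RI x y) (RI (x + h)) !rmorphD /=; ring.
    exact: p4.
- set z0 := a + d * (p +i* q).
  have [|l gl] := gd z0; first by exists p, q.
  have D0 := cabs_ge0 d; set D := cabs d in D0.
  (* A remainder at most $2 e_1 |d'|$ on the boundary gives a sum at most $8 e_1 |d'|^2$; [D + 1]
     instead of [D] covers [d = 0]. *)
  have e1 : 0 < e / (8 * (D + 1) ^+ 2) by rewrite divr_gt0 // mulr_gt0 // exprn_gt0; lra.
  have [r r0 H] := gl _ e1.
  have r1 : 0 < r / (2 * (D + 1)) by rewrite divr_gt0 //; lra.
  exists (r / (2 * (D + 1))) => // x y k hx hx1 hy hy1 xp yq.
  rewrite ltr_pdivlMr; last lra.
  have k0 := half_pow_gt0 R k; move=> kr.
  exists 0%N => m _; set a' := a + _; set d' := d * _.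
  have cd' : cabs d' = D * half_pow R k by rewrite cabsM cabs_real gtr0_norm.
  have hz0 : in_square a' d' z0.
    exists ((p - x) / half_pow R k), ((q - y) / half_pow R k).
    have itvE s s' : s <= s' <= s + half_pow R k -> unit_itv ((s' - s) / half_pow R k).
      by move=> hs; rewrite /unit_itv ler_pdivrMr // ler_pdivlMr // mul0r mul1r; lra.
    split; [exact: itvE | exact: itvE |].
    rewrite /z0 /a' /d' (RI p) (RI x) (RI (_ / _)) !rmorphM !rmorphB /= !fmorphV; field.
    by rewrite -cabs_eq0 cabs_real normr_eq0 gt_eqF.
  have -> : square_sum g m a' d' =
    square_sum (fun z => g z - (g z0 - l * z0 + l * z)) m a' d'.
    by rewrite square_sumB square_sum_affine subr0.
  apply: le_trans (square_sum_bound _ (B := e / (8 * (D + 1) ^+ 2) * (2 * cabs d')) _) _.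
    move=> z /on_in_square hz; have zz := in_square_dist hz hz0.
    have -> : g z - (g z0 - l * z0 + l * z) = g z - g z0 - l * (z - z0) by ring.
    apply: le_trans (H _ _) _; last by rewrite ler_wpM2l // ltW.
    by rewrite cd' in zz; nra.
  rewrite cd'; set h := half_pow R k in k0 *.
  have -> : 4 * (e / (8 * (D + 1) ^+ 2) * (2 * (D * h))) * (D * h) =
     e * h ^+ 2 * (D / (D + 1)) ^+ 2 by field; rewrite gt_eqF //; lra.
  have [e0' h0'] : 0 <= e /\ 0 <= h ^+ 2 by split; [exact: ltW | exact: sqr_ge0].
  apply: ler_piMr; first exact: mulr_ge0.
  by apply: exprn_ile1; rewrite ?divr_ge0 // ?ler_pdivrMr; lra.
Qed.

End SquareSums.

(** * Squares with a singular corner, and the sum of $1/(z-c)$ *)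

Section MeanValue.
Variable R : realType.
Local Notation C := R[i].
Implicit Types (z w u v a d c : C) (f g : C -> C) (m k : nat).
Local Notation I := (0 +i* 1 : C).

Lemma in_square_sub a d z x y : unit_itv x -> unit_itv y ->
  x <= 2^-1 -> y <= 2^-1 ->
  in_square (a + d * (x +i* y)) (d / 2) z -> in_square a d z.
Proof.
rewrite /unit_itv => hx hy hx2 hy2 [x' [y' [hx' hy' ->]]].
rewrite /unit_itv in hx' hy'.
exists (x + x' / 2), (y + y' / 2); rewrite /unit_itv; split; [lra | lra |].
have RI s t : (s +i* t : C) = s%:C + I * t%:C by rewrite [LHS]complexE.
by rewrite (RI x) (RI x') (RI (x + _)) !rmorphD !rmorphM /= !fmorphV !rmorph_nat; field.
Qed.

(** Quartering repeatedly towards the corner [c] leaves squares that avoid [c], where [goursat]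
    applies, and one tiny square at [c], whose sum is small because [g] is bounded there and the
    perimeter tends to 0. *)
Lemma goursat_corner g c d (r B : R) : 0 < r ->
  (forall z, in_square c d z -> z != c -> exists l, cdiff g z l) ->
  (forall z, cabs (z - c) < r -> cabs (g z) <= B) ->
  forall e : R, 0 < e -> ev_le (fun m => square_sum g m c d) e.
Proof.
move=> r0 gd gB e e0.
have [->|d0] := eqVneq d 0.
  exists 0%N => m _.
  have t0 u : trap g m u 0 = 0.
    by elim: m u => [|m IH] u /=; rewrite ?mulr0 // mul0r !IH addr0.
  by rewrite /square_sum mulr0 !t0 !subr0 addr0 cabs0 ltW.
have D0 : 0 < cabs d by rewrite cabs_gt0.
pose dk k := d * (half_pow R k)%:C.
have B0 : 0 <= B by apply: le_trans (cabs_ge0 (g c)) (gB c _); rewrite subrr cabs0.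
have dkS k : dk k.+1 = dk k / 2.
  by rewrite /dk [in RHS]half_powS rmorphD /=; field.
have dk0 k : dk k != 0.
  by rewrite mulf_neq0 // -cabs_eq0 cabs_real normr_eq0 gt_eqF ?half_pow_gt0.
have gdk k z : in_square c (dk k) z -> z != c -> exists l, cdiff g z l.
  move=> [x [y [hx hy ->]]]; apply: gd; have := half_pow_le R (leq0n k).
  have := half_pow_gt0 R k; rewrite /unit_itv in hx hy; rewrite [half_pow R 0]expr0 => h0 h1.
  exists (half_pow R k * x), (half_pow R k * y); split; rewrite /unit_itv; [nra | nra |].
  congr (_ + _); rewrite /dk -mulrA; congr (_ * _); apply/eqP.
  by rewrite eq_complex /= !mul0r subr0 addr0 !eqxx.
have step k e1 e2 : 0 < e2 -> ev_le (fun m => square_sum g m c (dk k.+1)) e1 ->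
   ev_le (fun m => square_sum g m c (dk k)) (e1 + e2).
  move=> e20 h; have e3 : 0 < e2 / 3 by rewrite divr_gt0.
  have -> : e1 + e2 = e1 + e2 / 3 + e2 / 3 + e2 / 3 by field.
  have hd : dk k / 2 != 0 by rewrite -dkS.
  (* A positive offset in one coordinate keeps the quarter away from [c]. *)
  have off (x y : R) z : (0 < x) || (0 < y) -> 0 <= x <= 2^-1 -> 0 <= y <= 2^-1 ->
    in_square (c + dk k * (x +i* y)) (dk k / 2) z -> exists l, cdiff g z l.
    move=> xy0 hx hy hz; apply: (gdk k); first by apply: in_square_sub hz; rewrite ?/unit_itv; lra.
    move: hz => [x' [y' [hx' hy' ->]]]; rewrite -subr_eq0.
    have -> : c + dk k * (x +i* y) + dk k / 2 * (x' +i* y') - c =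
      dk k / 2 * (((x + x) + x') +i* ((y + y) + y')).
      have -> : ((x + x) + x') +i* ((y + y) + y') = (x +i* y : C) + (x +i* y) + (x' +i* y') by [].
      by field.
    rewrite mulf_neq0 // eq_complex /= negb_and; rewrite /unit_itv in hx' hy'.
    by move: xy0 => /orP[h1|h1]; apply/orP; [left|right]; rewrite gt_eqF //; lra.
  apply: ev_le_split.
  - by rewrite -dkS.
  - apply: goursat e3 => z hz; apply: (off 2^-1 0); rewrite ?invr_gt0 ?ltr0n //; try lra.
    have -> : c + dk k * (2^-1 +i* 0) = c + dk k / 2 => //.
    by rewrite (_ : 2^-1 +i* 0 = (2^-1)%:C) // fmorphV rmorph_nat.
  - apply: goursat e3 => z hz; apply: (off 0 2^-1); rewrite ?invr_gt0 ?ltr0n ?orbT //; try lra.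
    have -> : c + dk k * (0 +i* 2^-1) = c + I * (dk k / 2) => //.
    rewrite [0 +i* 2^-1]complexE /= rmorph0 add0r fmorphV rmorph_nat; ring.
  - apply: goursat e3 => z hz; apply: (off 2^-1 2^-1); rewrite ?invr_gt0 ?ltr0n //; try lra.
    have -> : c + dk k * (2^-1 +i* 2^-1) = c + dk k / 2 + I * (dk k / 2) => //.
    rewrite [2^-1 +i* 2^-1]complexE /= fmorphV rmorph_nat; ring.
(* Each level spends half of the remaining allowance, so the total error stays within [e2] for every
   [k]. *)
have iter k : forall e1 e2 : R, 0 < e2 -> ev_le (fun m => square_sum g m c (dk k)) e1 ->
   ev_le (fun m => square_sum g m c d) (e1 + e2).
  elim: k => [|k IH] e1 e2 e20 h.
    have <- : dk 0%N = d by rewrite /dk /half_pow expr0 rmorph1 mulr1.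
    by apply: ev_leW h; lra.
  have e3 : 0 < e2 / 2 by rewrite divr_gt0.
  by rewrite [e2]splitr addrA; apply: IH => //; apply: step.
(* The first bound puts the corner square inside the disc where [B] holds; the second makes its sum,
   at most $4B|d_k|$, no larger than [e / 2]. *)
have s0 : 0 < Num.min (r / (2 * cabs d)) (e / (8 * (B + 1) * cabs d)).
  by rewrite lt_min !divr_gt0 // !mulr_gt0 //; lra.
have [k hk] := half_pow_small s0; move: hk; rewrite lt_min !ltr_pdivlMr ?mulr_gt0 //; last lra.
have h0 := half_pow_gt0 R k.
move=> /andP[h1 h2]; rewrite [e]splitr; apply: (iter k); first lra.
have cdk : cabs (dk k) = cabs d * half_pow R k by rewrite cabsM cabs_real gtr0_norm.
exists 0%N => m _; apply: le_trans (square_sum_bound _ (B := B) _) _.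
  move=> z /on_in_square hz; apply: gB.
  have hc : in_square c (dk k) c.
    by exists 0, 0; rewrite /unit_itv; split; [lra | lra | rewrite mulr0 addr0].
  by apply: le_lt_trans (in_square_dist hz hc) _; rewrite cdk; lra.
by rewrite cdk; nra.
Qed.

Lemma Im_inv_mul v u : complex.Im (v^-1 * u) =
  (complex.Re v * complex.Im u - complex.Im v * complex.Re u) /
  (complex.Re v ^+ 2 + complex.Im v ^+ 2).
Proof. by case: v u => x y [x' y'] /=; ring. Qed.

(* [K] is [Im (conj v * u) / (2 L^2)], a lower bound for the angle under which the
   segment from [v] to [v + u] is seen from the origin. *)
Lemma trap_inv_Im m v u (L K : R) : 0 < L -> 0 <= K ->
  complex.Re v * complex.Im u - complex.Im v * complex.Re u = 2 * L ^+ 2 * K ->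
  (forall t : R, unit_itv t -> let w := v + t%:C * u in
     0 < complex.Re w ^+ 2 + complex.Im w ^+ 2 <= 2 * L ^+ 2) ->
  K <= complex.Im (trap (fun z => z^-1) m v u).
Proof.
move=> L0; elim: m v u K => [|m IH] v u K K0 hK hw.
  have := hw 0; rewrite rmorph0 mul0r addr0 => /(_ _) h0.
  have := hw 1; rewrite rmorph1 mul1r => /(_ _) h1.
  have {}h0 := h0 ltac:(rewrite /unit_itv; lra); have {}h1 := h1 ltac:(rewrite /unit_itv; lra).
  cbv zeta in h0, h1.
  rewrite /trap (_ : (_ + _) / 2 * u = (2^-1)%:C * (v^-1 * u + (v + u)^-1 * u)); last first.
    by rewrite fmorphV rmorph_nat; ring.
  have ImZ (x : R) z : complex.Im (x%:C * z) = x * complex.Im z.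
    by case: z => z1 z2 /=; rewrite mul0r addr0.
  have ImD z z' : complex.Im (z + z') = complex.Im z + complex.Im z'.
    by case: z z' => ? ? [].
  rewrite ImZ ImD !Im_inv_mul.
  have e1 : K <= 2 * L ^+ 2 * K / (complex.Re v ^+ 2 + complex.Im v ^+ 2).
    by rewrite ler_pdivlMr; [rewrite mulrC ler_wpM2r; lra | lra].
  have e2 : K <= 2 * L ^+ 2 * K / (complex.Re (v + u) ^+ 2 + complex.Im (v + u) ^+ 2).
    by rewrite ler_pdivlMr; [rewrite mulrC ler_wpM2r; lra | lra].
  rewrite hK (_ : complex.Re (v + u) * _ - _ = 2 * L ^+ 2 * K); first lra.
  by rewrite -hK; case: v u {hK hw h0 h1 e1 e2} => ? ? [? ?] /=; ring.
have uE : u / 2 = (2^-1)%:C * u by rewrite fmorphV rmorph_nat mulrC.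
have ImD z z' : complex.Im (z + z') = complex.Im z + complex.Im z'.
  by case: z z' => ? ? [].
rewrite /= ImD [K]splitr lerD //.
  apply: IH; first by rewrite divr_ge0.
    rewrite uE; move: hK; case: v u {hw uE} => a b [p q] /= hK.
    by rewrite !mul0r subr0 addr0; lra.
  move=> t; rewrite /unit_itv => ht /=.
  have -> : v + t%:C * (u / 2) = v + (t / 2)%:C * u.
    by rewrite rmorphM /= fmorphV rmorph_nat; ring.
  by apply: hw; rewrite /unit_itv; lra.
apply: IH; first by rewrite divr_ge0.
  rewrite uE; move: hK; case: v u {hw uE} => a b [p q] /= hK.
  by rewrite !mul0r subr0 addr0; lra.
move=> t; rewrite /unit_itv => ht /=.
have -> : v + u / 2 + t%:C * (u / 2) = v + (1 / 2 + t / 2)%:C * u.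
  by rewrite rmorphD !rmorphM /= fmorphV rmorph1 rmorph_nat; ring.
by apply: hw; rewrite /unit_itv; lra.
Qed.

Lemma eq_trap_shift g m u d c : trap g m (u + c) d = trap (fun z => g (z + c)) m u d.
Proof.
elim: m u d => [|m IH] u d /=; first by rewrite (_ : u + c + d = u + d + c) //; ring.
by rewrite (_ : u + c + d / 2 = u + d / 2 + c) ?IH //; ring.
Qed.

(** Stands in for $\oint dz/(z-c) = 2\pi i$: [trap_inv_Im] with [K = 1] gives at least 1 for each
    side, where the integral would give $\pi/2$, uniformly in [m]. *)
Lemma square_sum_inv m c (L : R) : 0 < L ->
  4 <= complex.Im (square_sum (fun z => (z - c)^-1) m ((- L) +i* (- L) + c) (2 * L)%:C).
Proof.
move=> L0; rewrite /square_sum.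
have shift u d : trap (fun z => (z - c)^-1) m (u + c) d = trap (fun z => z^-1) m u d.
  by rewrite eq_trap_shift; apply: eq_trap => z; rewrite addrK.
have -> : (- L) +i* (- L) + c + (2 * L)%:C = (L +i* (- L)) + c.
  rewrite addrAC; congr (_ + _); apply/eqP; rewrite eq_complex /= addr0 eqxx andbT.
  by apply/eqP; ring.
have -> : I * (2 * L)%:C = 0 +i* (2 * L).
  by apply/eqP; rewrite eq_complex /= !mul0r mulr0 subr0 add0r mul1r !eqxx.
have -> : (- L) +i* (- L) + c + (0 +i* (2 * L)) = (L +i* L - (2 * L)%:C) + c.
  rewrite addrAC; congr (_ + _); apply/eqP; rewrite eq_complex /= !addr0.
  by apply/andP; split; apply/eqP; ring.
have -> : (- L) +i* (- L) + c = ((- L) +i* L - (0 +i* (2 * L))) + c.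
  congr (_ + _); apply/eqP; rewrite eq_complex /= .
  by apply/andP; split; apply/eqP; ring.
rewrite !shift.
have rv u d : trap (fun z => z^-1) m (u - d) d = - trap (fun z => z^-1) m u (- d).
  by rewrite -trap_rev opprK.
have ImD z z' : complex.Im (z + z') = complex.Im z + complex.Im z' by case: z z' => ? ? [].
have ImN z : complex.Im (- z) = - complex.Im z by case: z.
rewrite (rv (L +i* L)) (rv ((- L) +i* L)) !opprK.
have -> : (- L) +i* L - (0 +i* (2 * L)) = (- L) +i* (- L).
  by apply/eqP; rewrite eq_complex /=; apply/andP; split; apply/eqP; ring.
rewrite !ImD.
have gen v u : complex.Re v * complex.Im u - complex.Im v * complex.Re u = 2 * L ^+ 2 * 1 ->
  (forall t : R, unit_itv t -> let w := v + t%:C * u in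
     0 < complex.Re w ^+ 2 + complex.Im w ^+ 2 <= 2 * L ^+ 2) ->
  1 <= complex.Im (trap (fun z => z^-1) m v u) by apply: trap_inv_Im.
(* On each of the four sides the squared modulus has this form, which lies between $L^2$ and
   $2L^2$. *)
have aux (t X : R) : unit_itv t -> X = (L + t * (- (2 * L))) ^+ 2 + L ^+ 2 ->
    0 < X <= 2 * L ^+ 2.
  rewrite /unit_itv => /andP[t0 t1] ->; have : 0 < L ^+ 2 by rewrite exprn_gt0.
  have := sqr_ge0 (L + t * (- (2 * L))).
  have -> : (L + t * (- (2 * L))) ^+ 2 = L ^+ 2 - 4 * L ^+ 2 * (t * (1 - t)) by ring.
  have : 0 <= t * (1 - t) by rewrite mulr_ge0 // subr_ge0.
  by move=> h1 h2 h3; apply/andP; split; first lra; nra.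
have h1 : 1 <= complex.Im (trap (fun z : C => z^-1) m ((- L) +i* (- L)) (2 * L)%:C).
  by apply: gen => [/=|t ht /=]; [ring | apply: (aux t _ ht); ring].
have h2 : 1 <= complex.Im (trap (fun z : C => z^-1) m (L +i* (- L)) (0 +i* (2 * L))).
  by apply: gen => [/=|t ht /=]; [ring | apply: (aux t _ ht); ring].
have h3 : 1 <= complex.Im (trap (fun z : C => z^-1) m (L +i* L) (- (2 * L)%:C)).
  by apply: gen => [/=|t ht /=]; [ring | apply: (aux t _ ht); ring].
have h4 : 1 <= complex.Im (trap (fun z : C => z^-1) m ((- L) +i* L) (- (0 +i* (2 * L)))).
  by apply: gen => [/=|t ht /=]; [ring | apply: (aux t _ ht); ring].
by lra.
Qed.

End MeanValue.

(** * Cauchy estimates *)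

Section CauchyEstimates.
Variable R : realType.
Local Notation C := R[i].
Implicit Types (z w u v a d c h l : C) (f g F : C -> C) (m : nat) (k : C) (L M K r e : R).
Local Notation I := (0 +i* 1 : C).

(** The sums of $(f(z)-f(c))/(z-c)$ around the square of half side [L] about [c] become arbitrarily
    small, by [goursat_corner] on its four quadrants. Hence $|f(c)|$ times at least 4 is at most the
    sum of $f(z)/(z-c)$, which is bounded by $4 (M/L)(2L) = 8M$. *)
Lemma center_bound f c L M : 0 < L ->
  (forall z, cabs (z - c) <= 2 * L -> exists l, cdiff f z l) ->
  (forall z, L <= cabs (z - c) <= 2 * L -> cabs (f z) <= M) ->
  cabs (f c) <= 2 * M.
Proof.
move=> L0 fd fM.
pose g z := (f z - f c) / (z - c).
have gd z : cabs (z - c) <= 2 * L -> z != c -> exists l, cdiff g z l.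
  move=> /fd [l fl] zc; have zc0 : z - c != 0 by rewrite subr_eq0.
  have h1 := cdiffB fl (cdiff_cst (f c) z).
  have h2 := cdiff_comp (cdiffB (cdiff_id z) (cdiff_cst c z)) (cdiff_inv zc0).
  by eexists; exact: (cdiffM h1 h2).
have [r r0 [B gB]] : exists2 r, 0 < r &
    exists B : R, forall z, cabs (z - c) < r -> cabs (g z) <= B.
  have [|l /cdiff_lip [r r0 H]] := fd c; first by rewrite subrr cabs0; lra.
  exists r => //; exists (cabs l + 1) => z zr.
  (* At [c] itself the quotient is 0 / 0 = 0. *)
  have [->|zc] := eqVneq z c.
    by rewrite /g subrr mul0r cabs0; have := cabs_ge0 l; lra.
  by rewrite /g cabsM cabsV ler_pdivrMr ?cabs_gt0 ?subr_eq0 //; exact: H.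
pose lc : C := L%:C.
have clc : cabs lc = L by rewrite cabs_real gtr0_norm.
have quad d : cabs d = L -> forall e, 0 < e -> ev_le (fun m => square_sum g m c d) e.
  move=> dL; apply: (goursat_corner r0 _ gB) => z [x [y [hx hy ->]]]; apply: gd.
  rewrite addrC addKr cabsM dL mulrC.
  by apply: ler_wpM2r; [exact: ltW | exact: cabs_square].
pose a : C := (- L) +i* (- L) + c.
have aE : a = c - lc - I * lc.
  rewrite /a (_ : (- L) +i* (- L) = - lc - I * lc); first by ring.
  by apply/eqP; rewrite eq_complex /=; apply/andP; split; apply/eqP; ring.
have II x : I * (I * x) = - x by rewrite mulrA sqrI mulN1r.
have dE : (2 * L)%:C / 2 = lc by rewrite rmorphM /= rmorph_nat mulrC mulKf // pnatr_eq0.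
(* Rewrites each quadrant so that its base corner is [c], the possibly singular point. *)
have rot2 m d : square_sum g m (c + d + I * d) (- d) = square_sum g m c d.
  by rewrite -(square_sum_rot _ _ c) -(square_sum_rot _ _ (c + d)) II.
have rot3 m d : square_sum g m (c + I * d) (- (I * d)) = square_sum g m c d.
  by rewrite -[RHS]rot2 -[RHS]square_sum_rot mulrN; congr square_sum; ring.
have q1 m : square_sum g m a lc = square_sum g m c (- lc).
  by rewrite -rot2 opprK aE; congr square_sum; ring.
have q2 m : square_sum g m (a + lc) lc = square_sum g m c (- (I * lc)).
  by rewrite -[RHS]square_sum_rot mulrN II opprK aE; congr square_sum; ring.
have q3 m : square_sum g m (a + I * lc) lc = square_sum g m c (I * lc).
  by rewrite -rot3 II opprK aE; congr square_sum; ring.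
have q4 m : square_sum g m (a + lc + I * lc) lc = square_sum g m c lc.
  by rewrite aE; congr square_sum; ring.
apply/ler_addgt0Pl => e e0.
have e1 : 0 < e / 4 by rewrite divr_gt0.
have [] : ev_le (fun m => square_sum g m a (2 * L)%:C) (e / 4 + e / 4 + e / 4 + e / 4).
  apply: ev_le_split; rewrite dE.
  - have [m0 H] := quad (- lc) ltac:(by rewrite cabsN) _ e1.
    by exists m0 => m /H; rewrite q1.
  - have [m0 H] := quad (- (I * lc)) ltac:(by rewrite cabsN cabsM cabsi mul1r) _ e1.
    by exists m0 => m /H; rewrite q2.
  - have [m0 H] := quad (I * lc) ltac:(by rewrite cabsM cabsi mul1r) _ e1.
    by exists m0 => m /H; rewrite q3.
  - have [m0 H] := quad lc clc _ e1.
    by exists m0 => m /H; rewrite q4.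
move=> m0 /(_ m0 (leqnn _)).
have bd z : on_square a (2 * L)%:C z -> L <= cabs (z - c) <= 2 * L.
  case=> t; rewrite /unit_itv => ht hz.
  have [x [y [hzc hx hy hxy]]] : exists x y : R, [/\ z - c = x +i* y, `|x| <= L, `|y| <= L &
      (`|x| = L) \/ (`|y| = L)].
    have LL : `|L| = L by rewrite gtr0_norm.
    case: hz => ->; rewrite /a.
    - exists (- L + t * (2 * L)), (- L); split.
      + rewrite addrAC addrK; apply/eqP; rewrite eq_complex /=.
        by apply/andP; split; apply/eqP; ring.
      + by rewrite ler_norml; apply/andP; split; nra.
      + by rewrite normrN LL.
      + by right; rewrite normrN LL.
    - exists L, (- L + t * (2 * L)); split.
      + rewrite (_ : (- L) +i* (- L) + c + (2 * L)%:C + t%:C * (I * (2 * L)%:C) - c =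
          (- L) +i* (- L) + (2 * L)%:C + t%:C * (I * (2 * L)%:C)); last by ring.
        by apply/eqP; rewrite eq_complex /=; apply/andP; split; apply/eqP; ring.
      + by rewrite LL.
      + by rewrite ler_norml; apply/andP; split; nra.
      + by left.
    - exists (- L + t * (2 * L)), L; split.
      + rewrite (_ : (- L) +i* (- L) + c + I * (2 * L)%:C + t%:C * (2 * L)%:C - c =
          (- L) +i* (- L) + I * (2 * L)%:C + t%:C * (2 * L)%:C); last by ring.
        by apply/eqP; rewrite eq_complex /=; apply/andP; split; apply/eqP; ring.
      + by rewrite ler_norml; apply/andP; split; nra.
      + by rewrite LL.
      + by right.
    - exists (- L), (- L + t * (2 * L)); split.
      + rewrite addrAC addrK; apply/eqP; rewrite eq_complex /=.
        by apply/andP; split; apply/eqP; ring.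
      + by rewrite normrN LL.
      + by rewrite ler_norml; apply/andP; split; nra.
      + by left; rewrite normrN LL.
  rewrite hzc; apply/andP; split; last by apply: le_trans (cabs_le_ReIm _) _ => /=; lra.
  by case: hxy => <-; [have := Re_le_cabs (x +i* y) | have := Im_le_cabs (x +i* y)].
have -> : square_sum g m0 a (2 * L)%:C =
   square_sum (fun z => f z / (z - c)) m0 a (2 * L)%:C
   - f c * square_sum (fun z => (z - c)^-1) m0 a (2 * L)%:C.
  by rewrite -square_sumZ -square_sumB; apply: eq_square_sum => z; rewrite /g; ring.
set S1 := square_sum _ _ _ _; set S2 := square_sum _ _ _ _ => hS.
have b1 : cabs S1 <= 4 * (M / L) * cabs ((2 * L)%:C : C).
  apply: square_sum_bound => z /bd zL; rewrite cabsM cabsV ler_pdivrMr; last lra.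
  apply: le_trans (fM _ zL) _.
  have M0 : 0 <= M by apply: le_trans (cabs_ge0 _) (fM _ zL).
  by rewrite mulrAC ler_pdivlMr // ler_wpM2l //; lra.
have b2 : 4 <= cabs S2.
  apply: le_trans (square_sum_inv m0 c L0) _; apply: le_trans (Im_le_cabs _); exact: ler_norm.
have := cabs_tri S1 (f c * S2) 0; rewrite !subr0 cabsB cabsM.
rewrite cabs_real gtr0_norm ?mulr_gt0 // in b1.
have e8 : 4 * (M / L) * (2 * L) = 8 * M by field; rewrite gt_eqF.
rewrite e8 in b1.
have fc0 := cabs_ge0 (f c) => h.
have : cabs (f c) * 4 <= cabs (f c) * cabs S2 by rewrite ler_wpM2l.
by lra.
Qed.

(** An $N$-th root with $N$ tending to infinity removes the constants [a] and [b]; Bernoulli's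
    inequality makes this quantitative. *)
Lemma pow_compare (a b x y : R) : 0 < a -> 0 <= b -> 0 <= x -> 0 <= y ->
  (forall N, a * x ^+ N.+1 <= b * y ^+ N.+1) -> x <= y.
Proof.
move=> a0 b0 x0 y0 H; rewrite leNgt; apply/negP => yx.
have {x0} x0 : 0 < x by apply: le_lt_trans yx.
have [y00|yn0] := eqVneq y 0.
  by have := H 0%N; rewrite y00 !expr1 mulr0 leNgt mulr_gt0.
have {y0} y0 : 0 < y by rewrite lt_def yn0.
pose t := x / y - 1; have t0 : 0 < t by rewrite subr_gt0 ltr_pdivlMr // mul1r.
have xE : x = y * (1 + t) by rewrite /t; field.
have bern N : 1 + N%:R * t <= (1 + t) ^+ N.
  elim: N => [|N IH]; first by rewrite mul0r addr0 expr0.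
  have N0 : 0 <= N%:R :> R by rewrite ler0n.
  rewrite exprS -natr1 mulrDl; apply: le_trans (_ : (1 + t) * (1 + N%:R * t) <= _); first nra.
  by rewrite ler_wpM2l //; lra.
have [N hN] : exists N : nat, b / a / t < N%:R.
  by exists (Num.Def.archi_bound (b / a / t)); rewrite archi_boundP // !divr_ge0 // ltW.
have := H N; rewrite xE exprMn mulrCA [b * _]mulrC ler_pM2l ?exprn_gt0 // leNgt => /negP; apply.
rewrite mulrC -ltr_pdivrMr //; apply: lt_le_trans (bern N.+1).
rewrite -natr1 mulrDl; move: hN; rewrite ltr_pdivrMr //; lra.
Qed.

(** [center_bound] is applied at [z] with radius [3 * L]. On the annulus $3L \le |u-z| \le 6L$ one
    has $|u-c| \le 7L$ and $L \le |u-w| \le 8L$, so the difference quotient [q] is at most $2M/L$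
    there. Its high powers transfer this bound to [z], since [pow_compare] discards the factors
    $|z-w|$ and $16L$. *)
Lemma cdiff_lipschitz f c L M : 0 < L ->
  (forall z, cabs (z - c) <= 7 * L -> exists l, cdiff f z l) ->
  (forall z, cabs (z - c) <= 7 * L -> cabs (f z) <= M) ->
  forall z w, cabs (z - c) <= L -> cabs (w - c) <= L ->
    cabs (f z - f w) <= 2 * M / L * cabs (z - w).
Proof.
move=> L0 fd fM z w zL wL.
have [->|zw] := eqVneq z w; first by rewrite !subrr cabs0 mulr0.
have zw0 : 0 < cabs (z - w) by rewrite cabs_gt0 subr_eq0.
pose q u := (f u - f w) / (u - w).
have M0 : 0 <= M by apply: le_trans (cabs_ge0 _) (fM z _); lra.
suff : cabs (q z) <= 2 * M / L by rewrite /q cabsM cabsV ler_pdivrMr.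
apply: (@pow_compare (cabs (z - w)) (2 * (8 * L))) => //; rewrite ?cabs_ge0 ?divr_ge0 //; try lra.
move=> N; rewrite -cabsX -cabsM -mulrA.
have L3 : 0 < 3 * L by lra.
have ball u : cabs (u - z) <= 2 * (3 * L) -> cabs (u - c) <= 7 * L.
  by move=> h; have := cabs_tri z u c; lra.
apply: (@center_bound (fun u => (u - w) * q u ^+ N.+1) z (3 * L)) => //.
  move=> u /ball /fd [l fl].
  have [uw|uw] := eqVneq u w; last first.
    have uw0 : u - w != 0 by rewrite subr_eq0.
    have hw := cdiffB (cdiff_id u) (cdiff_cst w u).
    have hq := cdiffM (cdiffB fl (cdiff_cst (f w) u)) (cdiff_comp hw (cdiff_inv uw0)).
    by eexists; exact: (cdiffM hw (cdiffX N.+1 hq)).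
  (* At [w] the factor [u - w] repairs the artificial value [q w = 0]: the product vanishes there,
     and its derivative is the limit of $q^{N+1}$. *)
  exists (l ^+ N.+1) => e e0; rewrite uw in fl.
  have [d1 d10 H1] := cdiff_cont (cdiffX N.+1 (cdiff_id l)) e0.
  have [d2 d20 H2] := fl _ (divr_gt0 d10 (ltr0n R 2)).
  exists d2 => // v; rewrite uw subrr mul0r subr0 => vd.
  have [->|vw] := eqVneq v w; first by rewrite subrr mul0r mulr0 subr0 cabs0 mulr0.
  rewrite (_ : _ - _ = (q v ^+ N.+1 - l ^+ N.+1) * (v - w)); last by ring.
  rewrite cabsM ler_wpM2r ?cabs_ge0 //; apply: H1.
  have vw0 : 0 < cabs (v - w) by rewrite cabs_gt0 subr_eq0.
  apply: le_lt_trans (_ : d1 / 2 < _); last lra.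
  rewrite -(ler_pM2r vw0) -cabsM.
  have -> : (q v - l) * (v - w) = f v - f w - l * (v - w).
    by rewrite /q; field; rewrite subr_eq0.
  exact: H2.
move=> u hu; have /fM uM : cabs (u - c) <= 7 * L by apply: ball; lra.
have wM : cabs (f w) <= M by apply: fM; lra.
have h1 : L <= cabs (u - w).
  have := cabs_tri w u z; have := cabs_tri c w z; rewrite (cabsB c z); lra.
have h2 : cabs (u - w) <= 8 * L.
  have := cabs_tri z u w; have := cabs_tri c z w; rewrite (cabsB c w); lra.
cbv beta; rewrite cabsM cabsX; apply: ler_pM; rewrite ?exprn_ge0 ?cabs_ge0 //.
apply: lerXn2r; rewrite ?nnegrE ?cabs_ge0 ?divr_ge0 ?mulr_ge0 //; first exact: ltW.
rewrite /q cabsM cabsV; apply: ler_pM; rewrite ?invr_ge0 ?cabs_ge0 //.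
  by have := cabs_subD (f u) (f w); lra.
by rewrite lef_pV2 ?posrE //; lra.
Qed.

Lemma small_step (d : R) : 0 < d -> exists h : C, h != 0 /\ cabs h < d.
Proof.
move=> d0; exists (d / 2)%:C; rewrite -cabs_gt0 cabs_real gtr0_norm ?divr_gt0 //; split=> //.
lra.
Qed.

Lemma cdiff_le f c l K : cdiff f c l -> (exists2 r, 0 < r &
   forall z, cabs (z - c) < r -> cabs (f z - f c) <= K * cabs (z - c)) -> cabs l <= K.
Proof.
move=> fl [r r0 H]; apply/ler_addgt0Pl => e e0; have [d d0 H1] := fl _ e0.
have [|h [h0 hd]] := @small_step (Num.min r d); first by rewrite lt_min r0.
move: hd; rewrite lt_min => /andP[hr hd].
have ch : c + h - c = h by rewrite addrC addKr.
have := H (c + h); have := H1 (c + h); rewrite ch => /(_ hd) h1 /(_ hr) h2.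
rewrite -cabs_gt0 in h0; rewrite -(ler_pM2r h0) -cabsM.
have := cabs_tri 0 (f (c + h) - f c) (f (c + h) - f c - l * h).
by have := cabs_tri (f (c + h) - f c) (l * h) 0; rewrite !subr0 sub0r cabsN
 (cabsB (l * h)); lra.
Qed.

(** One-dimensional bisection, the second coordinate being idle. Near a parameter [p] the increment
    over an interval is split at [p], and the slack [e1] absorbs both differentiability errors. *)
Lemma mean_value_le F w v K :
  (forall t : R, unit_itv t -> exists l, cdiff F (w + t%:C * (v - w)) l /\ cabs l <= K) ->
  cabs (F v - F w) <= K * cabs (v - w).
Proof.
move=> FK; apply/ler_addgt0Pl => e e0; have D0 := cabs_ge0 (v - w).
set d := v - w; set D := cabs d.
have [e1 [e10 e1e]] : exists e1, 0 < e1 /\ e1 * D <= e.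
  exists (e / (D + 1)); split; first by rewrite divr_gt0 //; rewrite /D /d; lra.
  by rewrite mulrAC ler_pdivrMr; [rewrite ler_wpM2l; rewrite /D /d; lra | rewrite /D /d; lra].
pose G (x : R) := F (w + x%:C * d).
pose P (x y : R) (k : nat) := cabs (G (x + half_pow R k) - G x) <= (K + e1) * (half_pow R k * D).
have : P 0 0 0%N; last first.
  rewrite /P /G [half_pow R 0]expr0 add0r rmorph1 rmorph0 mul1r mul0r addr0 mul1r.
  have -> : w + d = v by rewrite /d addrC subrK.
  by move=> h; apply: le_trans h _; rewrite mulrDl; lra.
apply: (bisection (P := P)) => [x y k h p1 p2 _ _|p q hp hq].
  rewrite /P half_powS -/h; rewrite /P -/h in p1 p2.
  have := cabs_tri (G (x + h)) (G (x + h + h)) (G x); rewrite -addrA in p2 *.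
  by lra.
have [l [Fl lK]] := FK p hp; have [r r0 H] := Fl _ e10.
exists (r / (D + 1)); first by rewrite divr_gt0 //; rewrite /D /d; lra.
move=> x y k x0 x1 y0 y1 /andP[xp px] _; rewrite ltr_pdivlMr; last by rewrite /D /d; lra.
set h := half_pow R k => hr; have h0 : 0 < h := half_pow_gt0 R k.
rewrite /P -/h; rewrite -/h in px.
have DD : 0 <= D by [].
have G' (s : R) : `|s - p| <= h ->
    cabs (G s - G p - l * ((s - p)%:C * d)) <= e1 * (`|s - p| * D).
  move=> sp; have E : w + s%:C * d - (w + p%:C * d) = (s - p)%:C * d by rewrite rmorphB /=; ring.
  have := H (w + s%:C * d); rewrite E cabsM cabs_real -/D; apply.
  by have : `|s - p| * D <= h * D by [rewrite ler_wpM2r]; lra.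
have n1 : `|x + h - p| = x + h - p by rewrite ger0_norm //; lra.
have n2 : `|x - p| = p - x by rewrite ler0_norm; lra.
have h1 := G' (x + h); rewrite n1 in h1; have {}h1 := h1 ltac:(lra).
have h2 := G' x; rewrite n2 in h2; have {}h2 := h2 ltac:(lra).
have -> : G (x + h) - G x = (G (x + h) - G p - l * ((x + h - p)%:C * d)) -
   (G x - G p - l * ((x - p)%:C * d)) + l * (h%:C * d).
  by rewrite !rmorphB !rmorphD /=; ring.
apply: le_trans (cabsD _ _) _; apply: le_trans (lerD (cabs_subD _ _) (lexx _)) _.
rewrite (cabsM l) cabsM cabs_real gtr0_norm // -/D.
have : cabs l * (h * D) <= K * (h * D) by rewrite ler_wpM2r // mulr_ge0 // ltW.
by lra.
Qed.

(* The limit is the common point of the intervals of radius [K * cabs h] around the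
   values [G h], so no Cauchy sequence is needed. *)
Lemma quotient_limit (G : C -> C) r K : 0 < r -> 0 <= K ->
  (forall h k, h != 0 -> k != 0 -> cabs h < r -> cabs k < r ->
     cabs (G h - G k) <= K * (cabs h + cabs k)) ->
  exists l, forall h, h != 0 -> cabs h < r -> cabs (G h - l) <= 2 * K * cabs h.
Proof.
move=> r0 K0 GK.
have real_case (p : C -> R) : (forall x y, `|p x - p y| <= cabs (x - y)) ->
   exists a : R, forall h, h != 0 -> cabs h < r -> `|p (G h) - a| <= K * cabs h.
  move=> pp; pose A := [set x | exists h, [/\ h != 0, cabs h < r & x = p (G h) - K * cabs h]].
  have ub k : k != 0 -> cabs k < r -> ubound A (p (G k) + K * cabs k).
    move=> k0 kr _ [h [h0 hr ->]]; have := le_trans (pp _ _) (GK h k h0 k0 hr kr).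
    by rewrite ler_norml => /andP[_]; lra.
  have [k0 [k00 k0r]] := small_step r0.
  have A0 : A !=set0 by exists (p (G k0) - K * cabs k0), k0.
  have hA : has_ubound A by exists (p (G k0) + K * cabs k0); exact: ub.
  exists (sup A) => h h0 hr.
  have := ge_sup A0 (ub h h0 hr).
  have : p (G h) - K * cabs h <= sup A by apply: ub_le_sup => //; exists h.
  by rewrite ler_norml; lra.
have [|a Ha] := real_case (@complex.Re R).
  by move=> x y; apply: le_trans (Re_le_cabs _); case: x y => ? ? [? ?].
have [|b Hb] := real_case (@complex.Im R).
  by move=> x y; apply: le_trans (Im_le_cabs _); case: x y => ? ? [? ?].
exists (a +i* b) => h h0 hr; apply: le_trans (cabs_le_ReIm _) _.
have := Ha h h0 hr; have := Hb h h0 hr; case: (G h) => x y /=; lra.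
Qed.

(** The difference quotients [g h] of [f] are uniformly bounded, hence uniformly Lipschitz, and so
    is their limit [f1]. The mean value inequality then gives $|g_h - f_1| \le K_2|h|$ on a disc, so
    [g h - g k] is small there; by [cdiff_lipschitz] so is its derivative at [c]. Thus the quotients
    [G h c] of [f1] satisfy the hypothesis of [quotient_limit]. *)
Lemma cdiff_derivative f f1 c r : 0 < r ->
  (forall z, cabs (z - c) < r -> cdiff f z (f1 z)) -> exists l, cdiff f1 c l.
Proof.
move=> r0 fd0.
have [r1 [M [r10 fd fM]]] : exists r1 M, [/\ 0 < r1,
    forall z, cabs (z - c) <= 2 * (49 * r1) -> cdiff f z (f1 z) &
    forall z, cabs (z - c) <= 2 * (49 * r1) -> cabs (f z) <= M].
  have [|d d0 H] := cdiff_cont (fd0 c _) ltr01; first by rewrite subrr cabs0.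
  have m0 : 0 < Num.min r d by rewrite lt_min r0.
  (* Each Lipschitz estimate divides the radius by 7: from $98 r_1$ to $14 r_1$, from $7 r_1$ to
     $r_1$, and from $r_1/2$ to $r_1/14$. Dividing by 99 leaves $98 r_1$ strictly inside the
     disc. *)
  exists (Num.min r d / 99), (cabs (f c) + 1); split; first by rewrite divr_gt0.
    move=> z hz; apply: fd0; have : Num.min r d <= r by rewrite ge_min lexx.
    by lra.
  move=> z hz; have : Num.min r d <= d by rewrite ge_min lexx orbT.
  have := H z; have := cabs_revB (f z) (f c) => h1 h2 h3.
  by have := h2 ltac:(lra); lra.
have M0 : 0 <= M by apply: le_trans (cabs_ge0 _) (fM c _); rewrite subrr cabs0; lra.
pose K1 := 2 * M / (14 * r1); have K10 : 0 <= K1 by rewrite divr_ge0 ?mulr_ge0 // ltW.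
have lip1 z w : cabs (z - c) <= 14 * r1 -> cabs (w - c) <= 14 * r1 ->
    cabs (f z - f w) <= K1 * cabs (z - w).
  apply: cdiff_lipschitz; first by lra.
    by move=> u hu; exists (f1 u); apply: fd; lra.
  by move=> u hu; apply: fM; lra.
pose g h z := (f (z + h) - f z) / h.
pose G h z := (f1 (z + h) - f1 z) / h.
have zh z h : cabs (z + h - c) <= cabs (z - c) + cabs h.
  by rewrite addrAC; exact: cabsD.
have gd h z : h != 0 -> cabs h <= 7 * r1 -> cabs (z - c) <= 7 * r1 -> cdiff (g h) z (G h z).
  move=> h0 hr zr; rewrite /g /G mulrC.
  have e1 : cdiff (fun z => f (z + h)) z (f1 (z + h)).
    have hs : cdiff (fun z => z + h) z 1.
      by rewrite -[1]addr0; apply: cdiffD (cdiff_id z) (cdiff_cst h z).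
    rewrite -[f1 _]mulr1; apply: cdiff_comp hs _; apply: fd; have := zh z h; lra.
  have e2 : cdiff f z (f1 z) by apply: fd; lra.
  apply: cdiff_local ltr01 _ (cdiffZ h^-1 (cdiffB e1 e2)) => u _.
  by rewrite mulrC.
have gM h z : h != 0 -> cabs h <= 7 * r1 -> cabs (z - c) <= 7 * r1 -> cabs (g h z) <= K1.
  move=> h0 hr zr; rewrite /g cabsM cabsV ler_pdivrMr ?cabs_gt0 //.
  have hE : z + h - z = h by rewrite addrC addKr.
  have := lip1 (z + h) z; rewrite hE; apply; last lra.
  by have := zh z h; lra.
pose K2 := 2 * K1 / r1; have K20 : 0 <= K2.
  by apply: divr_ge0; [exact: mulr_ge0 | exact: ltW].
have lip2 z w : cabs (z - c) <= r1 -> cabs (w - c) <= r1 ->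
    cabs (f1 z - f1 w) <= K2 * cabs (z - w).
  move=> zr wr; apply/ler_addgt0Pl => e e0; have e2 : 0 < e / 2 by rewrite divr_gt0.
  have [|d1 d10 H1] := fd z _ _ e2; first by lra.
  have [|d2 d20 H2] := fd w _ _ e2; first by lra.
  have [|h [h0]] := @small_step (Num.min (Num.min d1 d2) r1); first by rewrite !lt_min d10 d20.
  rewrite !lt_min -andbA => /and3P[hd1 hd2 hr].
  have hp : 0 < cabs h by rewrite cabs_gt0.
  have gl u (d : R) : (forall w, cabs (w - u) < d ->
        cabs (f w - f u - f1 u * (w - u)) <= e / 2 * cabs (w - u)) ->
      cabs h < d -> cabs (g h u - f1 u) <= e / 2.
    move=> H hd; have hE : u + h - u = h by rewrite addrC addKr.
    have := H (u + h); rewrite hE => /(_ hd) {}H.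
    by rewrite -(ler_pM2r hp) -cabsM mulrBl /g divfK.
  have l1 := gl z d1 H1 hd1; have l2 := gl w d2 H2 hd2.
  have : cabs (g h z - g h w) <= K2 * cabs (z - w).
    apply: (@cdiff_lipschitz (g h) c r1 K1) => //.
      by move=> u hu; exists (G h u); apply: gd => //; lra.
    by move=> u hu; apply: gM => //; lra.
  have := cabs_tri (g h z) (f1 z) (f1 w); have := cabs_tri (g h w) (g h z) (f1 w).
  by rewrite (cabsB (f1 z) (g h z)); lra.
have taylor z h : cabs (z - c) <= r1 / 2 -> cabs h <= r1 / 2 ->
    cabs (f (z + h) - f z - f1 z * h) <= K2 * cabs h * cabs h.
  move=> zr hr; pose F u := f u - f1 z * u.
  have -> : f (z + h) - f z - f1 z * h = F (z + h) - F z by rewrite /F; ring.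
  have hE : z + h - z = h by rewrite addrC addKr.
  have := @mean_value_le F z (z + h) (K2 * cabs h); rewrite hE; apply=> t.
  rewrite /unit_itv => ht.
  have th : cabs (t%:C * h) <= cabs h.
    by rewrite cabsM cabs_real ger0_norm; have := cabs_ge0 h; nra.
  have ur := zh z (t%:C * h).
  exists (f1 (z + t%:C * h) - f1 z); split.
    apply: cdiffB; first by apply: fd; lra.
    by rewrite -[f1 z in X in cdiff _ _ X]mulr1; apply: cdiffZ; exact: cdiff_id.
  apply: le_trans (lip2 _ _ _ _) _; [lra | lra |].
  by rewrite addrC addKr ler_wpM2l.
have gf h z : h != 0 -> cabs (z - c) <= r1 / 2 -> cabs h <= r1 / 2 ->
    cabs (g h z - f1 z) <= K2 * cabs h.
  move=> h0 zr hr; have hp : 0 < cabs h by rewrite cabs_gt0.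
  by rewrite -(ler_pM2r hp) -cabsM mulrBl /g divfK //; exact: taylor.
pose L := r1 / 14; have L0 : 0 < L by rewrite divr_gt0.
have [] := @quotient_limit (fun h => G h c) (r1 / 2) (2 * K2 / L).
- by rewrite divr_gt0.
- by apply: divr_ge0; [exact: mulr_ge0 | exact: ltW].
- move=> h k h0 k0 hr kr.
  have : cdiff (fun z => g h z - g k z) c (G h c - G k c).
    by apply: cdiffB; apply: gd => //; rewrite ?subrr ?cabs0; lra.
  move=> /cdiff_le; apply; exists L => // z zL.
  have := @cdiff_lipschitz (fun z => g h z - g k z) c L (K2 * (cabs h + cabs k)) L0.
  move=> /(_ _ _ z c).
  rewrite (_ : 2 * (K2 * _) / L = 2 * K2 / L * (cabs h + cabs k)); last by ring.
  apply; rewrite ?subrr ?cabs0; try lra.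
    move=> u hu; exists (G h u - G k u).
    by apply: cdiffB; apply: gd => //; rewrite /L in hu; lra.
  move=> u; rewrite /L => hu; have := gf h u h0; have := gf k u k0 => h1 h2.
  have := cabs_tri (f1 u) (g h u) (g k u); rewrite (cabsB (f1 u) (g k u)).
  by have := h1 ltac:(lra) ltac:(lra); have := h2 ltac:(lra) ltac:(lra); lra.
move=> l Hl; exists l => e e0.
set K3 := 2 * (2 * K2 / L) in Hl.
have K30 : 0 <= K3.
  by apply: mulr_ge0 => //; apply: divr_ge0; [exact: mulr_ge0 | exact: ltW].
exists (Num.min (r1 / 2) (e / (K3 + 1))).
  by rewrite lt_min !divr_gt0 //; lra.
move=> w; rewrite lt_min => /andP[wr]; rewrite ltr_pdivlMr; last by lra.
move=> we.
have [->|wc] := eqVneq w c; first by rewrite !subrr mulr0 subr0 cabs0 mulr0.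
have wc0 : w - c != 0 by rewrite subr_eq0.
have wr' : cabs (w - c) < r1 / 2 by lra.
have := Hl _ wc0 wr'; have hp : 0 < cabs (w - c) by rewrite cabs_gt0.
rewrite -(ler_pM2r hp) -cabsM mulrBl /G divfK // (addrC c) subrK => h.
apply: le_trans h _; rewrite ler_wpM2r ?ltW //; lra.
Qed.

End CauchyEstimates.

(** * Link with [derivable], and Cauchy estimates of higher order *)

Section Bridge.
Variable R : realType.
Local Notation C := R[i].
Implicit Types (z w c l : C) (f g : C -> C) (d M : R).

Lemma nbhs_cabsP z (A : set C) :
  nbhs z A <-> exists2 d : R, 0 < d & forall w, cabs (w - z) < d -> A w.
Proof.
split=> [/nbhs_ballP [e /= e0 zeA]|[d d0 zdA]].
  (* A positive element of [R[i]] is real. *)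
  have eE : e = (complex.Re e)%:C.
    by move: e0; case: e {zeA} => a b; rewrite ltcE /= => /andP[/eqP -> _].
  exists (complex.Re e); first by move: e0; rewrite eE ltcR.
  move=> w wz; apply: zeA; rewrite /ball /= eE normc_cabs ltcR cabsB; exact: wz.
apply/nbhs_ballP; exists d%:C; rewrite /= ?ltcR // => w.
by rewrite /ball /= normc_cabs ltcR cabsB => /zdA.
Qed.

Lemma dnbhs_cabsP z (A : set C) : (\forall w \near z^', A w) <->
  exists2 d : R, 0 < d & forall w, w != z -> cabs (w - z) < d -> A w.
Proof.
split=> [/nbhs_cabsP [d d0 H]|[d d0 H]].
  by exists d => // w wz /H; apply.
by apply/nbhs_cabsP; exists d => // w wd wz; apply: H.
Qed.

Lemma cdiffP f z l :
  cdiff f z l <-> (fun h : C => h^-1 *: (f (h *: 1 + z) - f z)) @ 0^' --> l.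
Proof.
have key h : h != 0 -> cabs (l - h^-1 *: (f (h *: 1 + z) - f z)) * cabs h =
    cabs (f (h + z) - f z - l * h).
  move=> h0; rewrite -cabsM -cabsN; congr cabs.
  rewrite (_ : h *: 1 = h); last by rewrite /GRing.scale /= mulr1.
  by rewrite /GRing.scale /=; field.
split=> [fl|fl].
  apply/cvgrPdist_le => /= e e0.
  have eE : e = (complex.Re e)%:C.
    by move: e0; case: e => a b; rewrite ltcE /= => /andP[/eqP -> _].
  rewrite eE in e0 *; rewrite ltcR in e0.
  have [d d0 H] := fl _ e0; apply/dnbhs_cabsP; exists d => // h h0; rewrite subr0 => hd.
  rewrite normc_cabs lecR -(@ler_pM2r _ (cabs h)) ?cabs_gt0 // key //.
  by have := H (h + z); rewrite addrK; apply.
move=> e e0; move/cvgrPdist_le: fl => /(_ e%:C); rewrite /= ltcR => /(_ e0).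
move=> /dnbhs_cabsP [d d0 H]; exists d => // w wd.
have [->|wz] := eqVneq w z; first by rewrite !subrr mulr0 subr0 cabs0 mulr0.
have h0 : w - z != 0 by rewrite subr_eq0.
have := H _ h0; rewrite subr0 => /(_ wd); rewrite normc_cabs lecR.
by rewrite -(@ler_pM2r _ (cabs (w - z))) ?cabs_gt0 // key // subrK.
Qed.

Lemma cdiff_derive1 f z l : cdiff f z l -> derive1 f z = l.
Proof.
move=> /cdiffP fl; rewrite derive1E; apply: cvg_lim => //.
Qed.

Lemma derivable_cdiff f z : derivable f z 1 -> cdiff f z (derive1 f z).
Proof. by move=> fz; rewrite derive1E; apply/cdiffP. Qed.

Lemma holomorphic_atP f z : holomorphic_at f z ->
  exists2 d, 0 < d & forall w, cabs (w - z) < d -> cdiff f w (derive1 f w).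
Proof.
move=> /nbhs_cabsP [d d0 H]; exists d => // w /H; exact: derivable_cdiff.
Qed.

Lemma cdiff_derive1n f c d : (forall z, cabs (z - c) < d -> cdiff f z (derive1 f z)) ->
  forall i z, cabs (z - c) < d -> cdiff (derive1n i f) z (derive1n i.+1 f z).
Proof.
move=> fd; elim=> [|i IH] z zd; first by exact: fd.
have r0 : 0 < d - cabs (z - c) by rewrite subr_gt0.
have [|l hl] := @cdiff_derivative _ (derive1n i f) (derive1n i.+1 f) z _ r0.
  by move=> w wz; apply: IH; have := cabs_tri z w c; lra.
by have -> : derive1n i.+2 f z = l by exact: cdiff_derive1 hl.
Qed.

Lemma cdiff_bound f c l d M : 0 < d ->
  (forall z, cabs (z - c) <= d -> exists l, cdiff f z l) ->
  (forall z, cabs (z - c) <= d -> cabs (f z) <= M) ->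
  cdiff f c l -> cabs l <= 14 * M / d.
Proof.
move=> d0 fd fM fl; have d7 : 0 < d / 7 by rewrite divr_gt0.
have d77 : 7 * (d / 7) = d by field.
have := @cdiff_lipschitz _ f c (d / 7) M d7; rewrite d77 => /(_ fd fM) H.
apply: (cdiff_le fl); exists (d / 7) => // z zd; apply: le_trans (H z c _ _) _.
- exact: ltW.
- by rewrite subrr cabs0 ltW.
- by rewrite (_ : 2 * M / (d / 7) = 14 * M / d) //; field; rewrite gt_eqF.
Qed.

(** Half of the radius goes to bounding [F i] at all points near [c], the other half to one more
    first-order estimate. Stating it for abstract sequences, with [K] chosen before the centre,
    allows recentring in the induction. *)
Lemma iterated_bound i : exists2 K : R, 0 <= K & forall (F : nat -> C -> C) c d M, 0 < d ->
  (forall i z, cabs (z - c) <= d -> cdiff (F i) z (F i.+1 z)) ->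
  (forall z, cabs (z - c) <= d -> cabs (F 0%N z) <= M) ->
  cabs (F i c) <= K * M / d ^+ i.
Proof.
elim: i => [|i [K K0 IH]].
  exists 1 => // F c d M d0 _ FM; rewrite mul1r expr0 divr1; apply: FM.
  by rewrite subrr cabs0 ltW.
exists (28 * 2 ^+ i * K); first by rewrite !mulr_ge0 ?exprn_ge0.
move=> F c d M d0 Fd FM; have d2 : 0 < d / 2 by rewrite divr_gt0.
have ball w z : cabs (w - c) <= d / 2 -> cabs (z - w) <= d / 2 -> cabs (z - c) <= d.
  by move=> h1 h2; have := cabs_tri w z c; lra.
have -> : 28 * 2 ^+ i * K * M / d ^+ i.+1 = 14 * (K * M / (d / 2) ^+ i) / (d / 2).
  by rewrite exprMn exprVn exprS; field; rewrite ?gt_eqF ?exprn_gt0 // ?ltr0n.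
apply: (cdiff_bound (f := F i) (c := c) d2).
- by move=> z zd; exists (F i.+1 z); apply: Fd; lra.
- move=> w wd; apply: IH => //.
    by move=> j z zw; apply: Fd; exact: ball wd zw.
  by move=> z zw; apply: FM; exact: ball wd zw.
- by apply: Fd; rewrite subrr cabs0 ltW.
Qed.

End Bridge.

(** * Growth of solutions *)

Section Growth.
Variable R : realType.
Local Notation C := R[i].
Implicit Types (z w c l : C) (f g : C -> C) (p q : {poly C}) (phi psi : R -> R).

(* Nondecreasing majorants of order of growth at most [exp (A r^k)]. *)
Definition egrow phi := [/\ forall r, 1 <= r -> 0 <= phi r,
  forall r t, 1 <= r -> r <= t -> phi r <= phi t &
  exists A k, 0 <= A /\ forall r, 1 <= r -> phi r <= expR (A * r ^+ k)].

Lemma egrow_expX (A : R) k : 0 <= A -> egrow (fun r => expR (A * r ^+ k)).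
Proof.
move=> A0; split=> [r _|r t r1 rt|]; first exact: expR_ge0.
  rewrite ler_expR ler_wpM2l // lerXn2r // nnegrE; lra.
by exists A, k.
Qed.

Lemma egrow_cst (c : R) : 0 <= c -> egrow (fun=> c).
Proof.
move=> c0; split=> //; exists c, 0%N; split=> // r _.
by rewrite expr0 mulr1; have := expR_ge1Dx c; lra.
Qed.

Lemma egrow_id : egrow id.
Proof.
split=> [r r1|//|]; first by rewrite (le_trans ler01).
exists 1, 1%N; split=> // r r1; rewrite mul1r expr1.
by have := expR_ge1Dx r; lra.
Qed.

Lemma egrow_add_exponents (A A' : R) k k' r : 0 <= A -> 0 <= A' -> 1 <= r ->
  A * r ^+ k + A' * r ^+ k' <= (A + A') * r ^+ (k + k').
Proof.
move=> A0 A'0 r1; rewrite mulrDl lerD // ler_wpM2l // ler_weXn2l //.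
  exact: leq_addr.
exact: leq_addl.
Qed.

Lemma egrowM phi psi : egrow phi -> egrow psi -> egrow (fun r => phi r * psi r).
Proof.
move=> [p1 p2 [A [k [A0 p3]]]] [q1 q2 [A' [k' [A'0 q3]]]]; split.
- by move=> r r1; rewrite mulr_ge0 ?p1 ?q1.
- move=> r t r1 rt; apply: ler_pM; by [exact: p1 | exact: q1 | exact: p2 | exact: q2].
- exists (A + A'), (k + k')%N; split=> [|r r1]; first exact: addr_ge0.
  apply: le_trans (_ : expR (A * r ^+ k) * expR (A' * r ^+ k') <= _).
    by apply: ler_pM; by [exact: p1 | exact: q1 | exact: p3 | exact: q3].
  by rewrite -expRD ler_expR; exact: egrow_add_exponents.
Qed.

Lemma egrowD phi psi : egrow phi -> egrow psi -> egrow (fun r => phi r + psi r).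
Proof.
move=> [p1 p2 [A [k [A0 p3]]]] [q1 q2 [A' [k' [A'0 q3]]]]; split.
- by move=> r r1; rewrite addr_ge0 ?p1 ?q1.
- by move=> r t r1 rt; rewrite lerD ?p2 ?q2.
- exists (1 + (A + A')), (k + k')%N; split=> [|r r1]; first by rewrite !addr_ge0.
  have E0 (B : R) j : 0 <= B -> 1 <= expR (B * r ^+ j).
    move=> B0; have : 0 <= B * r ^+ j by rewrite mulr_ge0 // exprn_ge0 //; lra.
    by have := expR_ge1Dx (B * r ^+ j); lra.
  apply: le_trans (_ : expR 1 * (expR (A * r ^+ k) * expR (A' * r ^+ k')) <= _).
    have := E0 A k A0; have := E0 A' k' A'0; have := expR_ge1Dx (1 : R).
    have := p3 r r1; have := q3 r r1; set x := expR (A * _); set y := expR (A' * _).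
    move=> h1 h2 h3 h4 h5; have xy : x + y <= 2 * (x * y) by nra.
    have : 2 * (x * y) <= expR 1 * (x * y).
      by apply: ler_wpM2r; [apply: mulr_ge0; lra | lra].
    by lra.
  rewrite -!expRD ler_expR mulrDl mul1r lerD //.
    by rewrite exprn_ege1.
  exact: egrow_add_exponents.
Qed.

Lemma egrow_sum (J : Type) (s : seq J) (F : J -> R -> R) :
  (forall i, egrow (F i)) -> egrow (fun r => \sum_(i <- s) F i r).
Proof.
move=> FE; elim: s => [|i s IH].
  have -> : (fun r : R => \sum_(i <- [::]) F i r) = fun=> 0.
    by apply/funext => r; rewrite big_nil.
  exact: egrow_cst.
have -> : (fun r : R => \sum_(i <- i :: s) F i r) = fun r => F i r + \sum_(i <- s) F i r.
  by apply/funext => r; rewrite big_cons.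
exact: egrowD.
Qed.

Lemma egrowX phi k : egrow phi -> egrow (fun r => phi r ^+ k).
Proof.
move=> hphi; elim: k => [|k IH]; first exact: egrow_cst.
have -> : (fun r : R => phi r ^+ k.+1) = fun r => phi r * phi r ^+ k.
  by apply/funext => r; rewrite exprS.
exact: egrowM.
Qed.

Lemma egrow_shift phi : egrow phi -> egrow (fun r => phi (r + 1)).
Proof.
move=> [p1 p2 [A [k [A0 p3]]]]; split.
- by move=> r r1; apply: p1; lra.
- by move=> r t r1 rt; apply: p2; lra.
- exists (A * 2 ^+ k), k; split=> [|r r1]; first by rewrite mulr_ge0 // exprn_ge0.
  have r1' : 1 <= r + 1 by lra.
  apply: le_trans (p3 _ r1') _; rewrite ler_expR -mulrA -exprMn ler_wpM2l //.
  by rewrite lerXn2r // ?nnegrE; lra.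
Qed.

(** Nothing is asked inside the disc of radius [rho], which is where the poles will lie. *)
Definition dominated (rho : R) f := exists2 phi, egrow phi &
  forall z, rho <= cabs z -> cabs (f z) <= phi (cabs z).

Lemma dominatedM rho f g : dominated rho f -> dominated rho g ->
  dominated rho (fun z => f z * g z).
Proof.
move=> [p pe fp] [q qe gq]; exists (fun r => p r * q r); first exact: egrowM.
by move=> z hz; rewrite cabsM ler_pM ?cabs_ge0 ?fp ?gq.
Qed.

Lemma dominated_le rho rho' f : rho <= rho' -> dominated rho f -> dominated rho' f.
Proof. by move=> h [p pe fp]; exists p => // z hz; apply: fp; exact: le_trans hz. Qed.

Lemma dominated_sum rho (J : Type) (s : seq J) (F : J -> C -> C) :
  (forall i, dominated rho (F i)) -> dominated rho (fun z => \sum_(i <- s) F i z).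
Proof.
move=> /(_ _)/cid2 FE; exists (fun r => \sum_(i <- s) s2val (FE i) r).
  by apply: egrow_sum => i; case: (FE i).
move=> z hz; apply: le_trans (cabs_sum _ _) _; apply: ler_sum => i _.
by case: (FE i) => p /= _; apply.
Qed.

Lemma poly_upper p : exists A k, 0 <= A /\
  forall z, 1 <= cabs z -> cabs p.[z] <= A * cabs z ^+ k.
Proof.
exists (\sum_(i < size p) cabs p`_i), (size p); split=> [|z z1].
  by apply: sumr_ge0 => i _; exact: cabs_ge0.
rewrite horner_coef (le_trans (cabs_sum _ _)) // mulr_suml; apply: ler_sum => i _.
by rewrite cabsM cabsX ler_wpM2l ?cabs_ge0 // ler_weXn2l // ltnW.
Qed.

Lemma poly_lower q : q != 0 -> exists rho a : R, [/\ 1 <= rho, 0 < a &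
  forall z, rho <= cabs z -> a <= cabs q.[z]].
Proof.
move=> q0; have [rs ->] := closed_field_poly_normal q.
(* Beyond this radius every root is at distance at least 1, so each linear factor has modulus at
   least 1. *)
exists (1 + \sum_(x <- rs) cabs x), (cabs (lead_coef q)); split.
- by rewrite lerDl; apply: sumr_ge0 => i _; exact: cabs_ge0.
- by rewrite cabs_gt0 lead_coef_eq0.
move=> z hz; rewrite hornerZ cabsM ler_peMr ?cabs_ge0 // horner_prod.
elim: rs hz => [|x rs IH]; first by rewrite !big_nil cabs1.
rewrite !big_cons hornerXsubC cabsM => hz.
have s0 : 0 <= \sum_(y <- rs) cabs y by apply: sumr_ge0 => i _; exact: cabs_ge0.
have x0 := cabs_ge0 x; rewrite -[1]mulr1 ler_pM //.
  by have := cabs_revB z x; lra.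
by apply: IH; lra.
Qed.

Lemma cabs_cexp z : cabs (cexp z) = expR (complex.Re z).
Proof.
rewrite /cabs /cexp /= !exprMn -mulrDr cos2Dsin2 mulr1 sqrtr_sqr ger0_norm.
  by [].
exact: expR_ge0.
Qed.

Lemma dominated_cexp p : dominated 1 (fun z => cexp p.[z]).
Proof.
have [A [k [A0 H]]] := poly_upper p.
exists (fun r => expR (A * r ^+ k)); first exact: egrow_expX.
move=> z hz; rewrite cabs_cexp ler_expR (le_trans _ (H _ hz)) //.
by apply: le_trans (Re_le_cabs _); exact: ler_norm.
Qed.

Lemma pole_unbounded f z : pole f z -> forall M d, 0 < d ->
  exists2 w, cabs (w - z) < d & M < cabs (f w).
Proof.
move=> [k [k0 [g [/holomorphic_atP [d1 d10 gd] gz /dnbhs_cabsP [d2 d20 fg]]]]] M d d0.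
have gc : cdiff g z (derive1 g z) by apply: gd; rewrite subrr cabs0.
have G0 : 0 < cabs (g z) / 2 by rewrite divr_gt0 // cabs_gt0.
have [d3 d30 H] := cdiff_cont gc G0.
pose N := `|M| + 1; have N0 : 0 < N by rewrite /N; have := normr_ge0 M; lra.
pose m := Num.min (Num.min (Num.min d d2) d3) (Num.min 1 (cabs (g z) / 2 / N)).
have [|h [h0]] := @small_step _ m.
  by rewrite !lt_min d0 d20 d30 ltr01 divr_gt0.
rewrite !lt_min -!andbA => /and5P[hd h2 h3 h1 hN].
have hz : z + h - z = h by rewrite addrC addKr.
exists (z + h); first by rewrite hz.
have hp : 0 < cabs h by rewrite cabs_gt0.
rewrite fg ?hz //; last by rewrite -subr_eq0 hz.
rewrite cabsM cabsV cabsX ltr_pdivlMr ?exprn_gt0 //.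
have := H (z + h); rewrite hz => /(_ h3) {}H.
have {}H : cabs (g z) / 2 <= cabs (g (z + h)).
  by have := cabs_tri (g (z + h)) (g z) 0; rewrite !subr0 (cabsB (g z)); lra.
apply: lt_le_trans H; move: hN; rewrite ltr_pdivlMr // mulrC; apply: le_lt_trans.
apply: le_trans (_ : N * cabs h ^+ k <= _).
  by rewrite ler_wpM2r ?exprn_ge0 ?cabs_ge0 // /N; have := ler_norm M; lra.
apply: ler_wpM2l; first exact: ltW.
case: k k0 {fg} => // k _; rewrite exprS; apply: ler_piMr; first exact: cabs_ge0.
by apply: exprn_ile1; [exact: cabs_ge0 | exact: ltW].
Qed.

Lemma bounded_not_pole f z M d : 0 < d ->
  (forall w, cabs (w - z) < d -> cabs (f w) <= M) -> ~ pole f z.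
Proof.
by move=> d0 H /pole_unbounded /(_ M d d0) [w /H]; rewrite leNgt => /negP.
Qed.

Lemma rational_at_infinity b : rational_function b -> exists rho, [/\ 1 <= rho,
  forall z, rho <= cabs z -> ~ pole b z & dominated rho b].
Proof.
move=> [p [q [q0 _ bE]]].
have [A [k [A0 up]]] := poly_upper p; have [rho [a [r1 a0 lo]]] := poly_lower q0.
have bb z : rho <= cabs z -> cabs (b z) <= A / a * cabs z ^+ k.
  move=> hz; rewrite bE cabsM cabsV mulrAC ler_pM ?invr_ge0 ?cabs_ge0 //.
    by apply: up; lra.
  by rewrite lef_pV2 ?posrE ?lo // (lt_le_trans a0) ?lo.
(* The extra 1 leaves a unit disc around [z] on which the bound for [b] holds, which excludes a pole
   at [z]. *)
exists (rho + 1); split; first by lra.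
  move=> z hz; apply: (@bounded_not_pole b z (A / a * (cabs z + 1) ^+ k) 1) => // w wz.
  have := cabs_revB z w; rewrite cabsB => zw.
  apply: le_trans (bb w _) _; first by lra.
  have := cabs_tri z w 0; rewrite !subr0 => wz'; have w0 := cabs_ge0 w.
  rewrite ler_wpM2l ?divr_ge0 ?(ltW a0) //; apply: lerXn2r; rewrite ?nnegrE; lra.
exists (fun r => A / a * r ^+ k).
  apply: egrowM; last exact/egrowX/egrow_id.
  by apply: egrow_cst; rewrite divr_ge0 // ltW.
by move=> z hz; apply: bb; lra.
Qed.

(** Bisection on the square $[-r, r]^2$, parametrised by [pt], where only the points of modulus at
    least [rho] count. *)
Lemma bounded_annulus f (rho : R) : (forall z, rho <= cabs z -> ccont f z) ->
  forall r, exists X, forall z, rho <= cabs z <= r -> cabs (f z) <= X.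
Proof.
move=> fc r; have [r0|r0] := ltP r 0.
  by exists 0 => z; have := cabs_ge0 z; lra.
pose pt (x y : R) : C := ((2 * r) * x - r) +i* ((2 * r) * y - r).
pose P (x y : R) (k : nat) := exists X, forall x' y' : R,
  x <= x' <= x + half_pow R k -> y <= y' <= y + half_pow R k ->
  rho <= cabs (pt x' y') -> cabs (f (pt x' y')) <= X.
have : P 0 0 0%N; last first.
  move=> [X H]; exists X => z /andP[z1 z2].
  have [r00|rn0] := eqVneq r 0.
    have z0 : z = 0.
      by apply/eqP; rewrite -cabs_eq0 eq_le cabs_ge0 andbT; lra.
    have := H 0 0; rewrite [half_pow R 0]expr0 /pt r00 !mulr0 subr0.
    by rewrite z0 in z1 *; apply=> //; lra.
  have rp : 0 < r by rewrite lt_def rn0.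
  have hE : z = pt ((complex.Re z + r) / (2 * r)) ((complex.Im z + r) / (2 * r)).
    rewrite /pt; case: z {z1 z2} => a b /=.
    by congr Complex; field.
  have R1 := Re_le_cabs z; have I1 := Im_le_cabs z.
  rewrite hE; apply: H; last by rewrite -hE.
    rewrite [half_pow R 0]expr0 add0r; rewrite ler_norml in R1.
    by rewrite ler_pdivrMr ?mulr_gt0 // ler_pdivlMr ?mulr_gt0 //; lra.
  rewrite [half_pow R 0]expr0 add0r; rewrite ler_norml in I1.
  by rewrite ler_pdivrMr ?mulr_gt0 // ler_pdivlMr ?mulr_gt0 //; lra.
apply: (bisection (P := P)) => [x y k h [X1 H1] [X2 H2] [X3 H3] [X4 H4]|p q hp hq].
  exists (Num.max (Num.max X1 X2) (Num.max X3 X4)) => x' y'.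
  rewrite half_powS -/h => hx hy hr; rewrite -/h in H1 H2 H3 H4; rewrite !le_max.
  have [lx|lx] := leP x' (x + h); have [ly|ly] := leP y' (y + h).
  - by rewrite H1 //; lra.
  - by rewrite H3 ?orbT //; lra.
  - by rewrite H2 ?orbT //; lra.
  - by rewrite H4 ?orbT //; lra.
set c := pt p q.
have near x y k d : 0 < d -> x <= p <= x + half_pow R k -> y <= q <= y + half_pow R k ->
    half_pow R k < d / (4 * r + 1) -> forall x' y' : R,
    x <= x' <= x + half_pow R k -> y <= y' <= y + half_pow R k ->
    cabs (pt x' y' - c) < d.
  move=> d0 hx hy hk x' y' hx' hy'; apply: le_lt_trans (cabs_le_ReIm _) _ => /=.
  move: hk; rewrite ltr_pdivlMr; last lra; move=> hk.
  have k0 := half_pow_gt0 R k.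
  have -> : 2 * r * x' - r - (2 * r * p - r) = 2 * r * (x' - p) by ring.
  have -> : 2 * r * y' - r - (2 * r * q - r) = 2 * r * (y' - q) by ring.
  rewrite !normrM (ger0_norm r0) ger0_norm //.
  have a1 : `|x' - p| <= half_pow R k by rewrite ler_norml; lra.
  have a2 : `|y' - q| <= half_pow R k by rewrite ler_norml; lra.
  have : 2 * r * `|x' - p| <= 2 * r * half_pow R k by rewrite ler_wpM2l // mulr_ge0.
  have : 2 * r * `|y' - q| <= 2 * r * half_pow R k by rewrite ler_wpM2l // mulr_ge0.
  by lra.
(* Around a point of modulus less than [rho], small squares contain no point that counts, so any
   bound will do. *)
have [cr|cr] := ltP (cabs c) rho.
  exists ((rho - cabs c) / (4 * r + 1)); first by rewrite divr_gt0 //; lra.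
  move=> x y k _ _ _ _ hx hy hk; exists 0 => x' y' hx' hy' hr.
  have d0 : 0 < rho - cabs c by lra.
  have := near x y k _ d0 hx hy hk x' y' hx' hy'.
  by have := cabs_revB (pt x' y') c; lra.
have [d d0 H] := fc c cr 1 ltr01.
exists (d / (4 * r + 1)); first by rewrite divr_gt0 //; lra.
move=> x y k _ _ _ _ hx hy hk; exists (cabs (f c) + 1) => x' y' hx' hy' hr.
have := H _ (near x y k _ d0 hx hy hk x' y' hx' hy').
by have := cabs_revB (f (pt x' y')) (f c); lra.
Qed.

End Growth.

(** * The maximum modulus of a solution *)

Section GrowthOfSolution.
Variable R : realType.
Local Notation C := R[i].
Implicit Types (z w u : C) (f : C -> C).

(** The derivative of $f^{n+1}$ is $(n+1)f^nf' = (n+1)(H - P(z,f))$. The mean value inequality along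
    the radius from the circle of radius [rho + 1] to [z] bounds the increment, with Cauchy's
    estimates on discs of radius [d] for the derivatives in $P$. *)
Lemma solution_step (n s : nat) f (b : 'I_s.+1 -> C -> C) (H : C -> C) (rho m0 T : R)
    (beta : 'I_s.+1 -> R -> R) (K : nat -> R) (h : R -> R) : 1 <= rho ->
  (forall i z, rho <= cabs z -> cdiff (derive1n i f) z (derive1n i.+1 f z)) ->
  (forall z, rho <= cabs z -> f z ^+ n * derive1 f z + lin_diff_poly b f z = H z) ->
  (forall i, egrow (beta i)) -> egrow h ->
  (forall i z, rho <= cabs z -> cabs (b i z) <= beta i (cabs z)) ->
  (forall z, rho <= cabs z -> cabs (H z) <= h (cabs z)) ->
  (forall i, 0 <= K i) ->
  (forall i (F : nat -> C -> C) c (d M : R), 0 < d ->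
    (forall i z, cabs (z - c) <= d -> cdiff (F i) z (F i.+1 z)) ->
    (forall z, cabs (z - c) <= d -> cabs (F 0%N z) <= M) ->
    cabs (F i c) <= K i * M / d ^+ i) ->
  (forall z, rho <= cabs z <= rho + 1 -> cabs (f z) <= m0) ->
  forall (d X : R) z, 0 < d <= 1 -> 0 <= X -> rho + 1 <= cabs z -> cabs z + d <= T ->
  (forall w, rho <= cabs w <= cabs z + d -> cabs (f w) <= X) ->
  cabs (f z) ^+ n.+1 <= (m0 ^+ n.+1 + n.+1%:R * (T * h T)) +
    n.+1%:R * (T * \sum_i beta i T * K i) * (X / d ^+ s).
Proof.
move=> rho1 fd feq be he bb Hh K0 KP fm d X z /andP[d0 d1] X0 z1 zT fX.
set S := \sum_i _.
have T1 : 1 <= T by lra.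
have zp : 0 < cabs z by lra.
(* The segment starts at modulus [rho + 1], so the discs of radius [d <= 1] about its points stay
   where $|w| \ge \rho$. *)
pose t0 := (rho + 1) / cabs z.
have t01 : 0 < t0 <= 1 by rewrite divr_gt0 ?ler_pdivrMr //; lra.
have t0z : t0 * cabs z = rho + 1 by rewrite /t0 divfK // gt_eqF.
clearbody t0.
have S0 : 0 <= S.
  by apply: sumr_ge0 => i _; apply: mulr_ge0 => //; case: (be i) => h1 _ _; apply: h1.
have hT0 : 0 <= h T by case: he => h1 _ _; apply: h1.
have Xd0 : 0 <= X / d ^+ s by rewrite divr_ge0 // exprn_ge0 // ltW.
set B := n.+1%:R * (h T + S * (X / d ^+ s)).
have B0 : 0 <= B by rewrite mulr_ge0 ?ler0n // addr_ge0 // mulr_ge0.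
have main : cabs (f z ^+ n.+1 - f (t0%:C * z) ^+ n.+1) <= B * cabs (z - t0%:C * z).
  apply: (@mean_value_le _ (fun w => f w ^+ n.+1)) => t; rewrite /unit_itv => ht.
  pose tau := t0 + t * (1 - t0).
  have tau1 : t0 <= tau <= 1.
    have : 0 <= t * (1 - t0) by rewrite mulr_ge0 //; lra.
    have : t * (1 - t0) <= 1 - t0 by rewrite ler_piMl //; lra.
    by rewrite /tau; lra.
  have -> : t0%:C * z + t%:C * (z - t0%:C * z) = tau%:C * z.
    by rewrite /tau rmorphD rmorphM rmorphB /= rmorph1; ring.
  set u := _ * z; have cu : cabs u = tau * cabs z.
    by rewrite cabsM cabs_real ger0_norm //; lra.
  have u1 : rho + 1 <= cabs u by rewrite cu -t0z ler_wpM2r //; lra.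
  have u2 : cabs u <= cabs z by rewrite cu ler_piMl //; lra.
  have ur : rho <= cabs u by lra.
  have u11 : 1 <= cabs u by lra.
  have uT : cabs u <= T by lra.
  have := cdiffX n.+1 (fd 0%N u ur); rewrite /= => hd.
  eexists; split; first exact: hd.
  have nn : cabs (n.+1%:R : C) = n.+1%:R by exact: cabs_nat.
  rewrite -mulrA cabsM nn ler_wpM2l ?ler0n //.
  have -> : f u ^+ n * derive1 f u = H u - lin_diff_poly b f u by rewrite -feq // addrK.
  apply: le_trans (cabs_subD _ _) _; apply: lerD.
    by apply: le_trans (Hh _ ur) _; case: he => _ h2 _; apply: h2.
  apply: le_trans (cabs_sum _ _) _; rewrite /S mulr_suml; apply: ler_sum => i _.
  rewrite cabsM -mulrA; apply: ler_pM; rewrite ?cabs_ge0 //.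
    by apply: le_trans (bb _ _ ur) _; case: (be i) => _ h2 _; apply: h2.
  have ball w : cabs (w - u) <= d -> rho <= cabs w <= cabs z + d.
    move=> wu; have := cabs_tri u w 0; have := cabs_tri w u 0; rewrite !subr0 (cabsB u w).
    by lra.
  apply: le_trans (_ : K i * X / d ^+ i <= _).
    apply: (KP i (fun j => derive1n j f)) => // [j w /ball /andP[wr _]|w /ball]; first exact: fd.
    exact: fX.
  (* Since [d <= 1], the largest power $d^{-s}$ dominates every $d^{-i}$. *)
  rewrite -mulrA ler_wpM2l // ler_wpM2l // lef_pV2 ?posrE ?exprn_gt0 //.
  by apply: ler_wiXn2l => //; [exact: ltW | rewrite -ltnS].
have w0 : cabs (t0%:C * z) = rho + 1.
  by rewrite cabsM cabs_real ger0_norm ?t0z //; lra.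
have f0 : cabs (f (t0%:C * z)) ^+ n.+1 <= m0 ^+ n.+1.
  have h1 : cabs (f (t0%:C * z)) <= m0 by apply: fm; rewrite w0; lra.
  have m00 := le_trans (cabs_ge0 _) h1.
  by apply: lerXn2r => //; rewrite nnegrE cabs_ge0.
have zz : cabs (z - t0%:C * z) <= T.
  have -> : z - t0%:C * z = (1 - t0)%:C * z by rewrite rmorphB /= rmorph1; ring.
  rewrite cabsM cabs_real ger0_norm; last lra.
  by have : (1 - t0) * cabs z <= cabs z; [rewrite ler_piMl //; lra | lra].
have := cabs_revB (f z ^+ n.+1) (f (t0%:C * z) ^+ n.+1); rewrite !cabsX => h1.
have h2 : B * cabs (z - t0%:C * z) <= B * T by rewrite ler_wpM2l.
have -> : n.+1%:R * (T * S) * (X / d ^+ s) = n.+1%:R * (S * (X / d ^+ s)) * T by ring.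
have -> : n.+1%:R * (T * h T) = n.+1%:R * h T * T by ring.
have h3 : B * T = n.+1%:R * h T * T + n.+1%:R * (S * (X / d ^+ s)) * T.
  by rewrite /B; ring.
by clearbody B; lra.
Qed.

(* If [|f| > Y] somewhere on a circle of radius [r], the equation forces [|f| > Y^2] on a
   slightly larger circle; iterating with total increase at most [1] contradicts the
   boundedness of [f] on the annulus of outer radius [r + 1]. *)
Lemma solution_growth (n s : nat) f (b : 'I_s.+1 -> C -> C) (H : C -> C) (rho : R) :
  (3 <= n)%N -> 1 <= rho ->
  (forall i z, rho <= cabs z -> cdiff (derive1n i f) z (derive1n i.+1 f z)) ->
  (forall z, rho <= cabs z -> f z ^+ n * derive1 f z + lin_diff_poly b f z = H z) ->
  (forall i, dominated rho (b i)) -> dominated rho H ->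
  dominated (rho + 1) f.
Proof.
move=> n3 rho1 fd feq bd [h he Hh].
have /choice [beta betaP] : forall i, exists phi, egrow phi /\
    forall z, rho <= cabs z -> cabs (b i z) <= phi (cabs z).
  by move=> i; have [phi] := bd i; exists phi.
have /choice [K KP] : forall i, exists K : R, 0 <= K /\
    forall (F : nat -> C -> C) c (d M : R), 0 < d ->
    (forall i z, cabs (z - c) <= d -> cdiff (F i) z (F i.+1 z)) ->
    (forall z, cabs (z - c) <= d -> cabs (F 0%N z) <= M) ->
    cabs (F i c) <= K * M / d ^+ i.
  by move=> i; have [k] := iterated_bound R i; exists k.
have fc z : rho <= cabs z -> ccont f z by move=> /(fd 0%N) /cdiff_cont.
have [m1 fm1] := bounded_annulus fc (rho + 1).
pose m0 := Num.max m1 0.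
have m00 : 0 <= m0 by rewrite le_max lexx orbT.
have fm z : rho <= cabs z <= rho + 1 -> cabs (f z) <= m0.
  by move=> /fm1 hz; rewrite le_max hz.
pose A r := m0 ^+ n.+1 + n.+1%:R * (r * h r).
pose D r := n.+1%:R * (r * \sum_i beta i r * K i).
have Ae : egrow A.
  apply: egrowD; first by apply: egrow_cst; rewrite exprn_ge0.
  by apply: egrowM; [apply: egrow_cst | apply: egrowM => //; exact: egrow_id].
have De : egrow D.
  apply: egrowM; first exact: egrow_cst.
  apply: egrowM; first exact: egrow_id.
  apply: egrow_sum => i; apply: egrowM; first by have [] := betaP i.
  by apply: egrow_cst; have [] := KP i.
(* The terms serve in turn to make the iterates unbounded, to cover the annulus near [rho], to
   absorb [A] and [D] at radius [r + 1], and to absorb the powers of 2 coming from $d^{-s}$. *)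
pose Y r := 2 + m0 + 2 * A (r + 1) + 2 * D (r + 1) + 2 ^+ s.
exists Y.
  have e2 : egrow (fun=> 2 : R) by exact: egrow_cst.
  apply: egrowD; last by apply: egrow_cst; rewrite exprn_ge0.
  apply: egrowD; last by apply: egrowM => //; exact: egrow_shift.
  apply: egrowD; last by apply: egrowM => //; exact: egrow_shift.
  by apply: egrow_cst; lra.
move=> z hz; rewrite leNgt; apply/negP => Yf.
set r := cabs z in hz Yf; pose T := r + 1.
have T1 : 1 <= T by rewrite /T; lra.
have A0 : 0 <= A T by case: Ae => h1 _ _; apply: h1.
have D0 : 0 <= D T by case: De => h1 _ _; apply: h1.
have s1 : 1 <= 2 ^+ s :> R by rewrite exprn_ege1 // ler1n.
set y := Y r in Yf.
have [y2 ym yA yD ys] : [/\ 2 <= y, m0 <= y, 2 * A T <= y, 2 * D T <= y & 2 ^+ s <= y].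
  by rewrite /y /Y -/T; split; lra.
(* The radius still available after [k] steps is [half_pow R k], so the points never leave the disc
   of radius [T]. *)
have step k : exists w, [/\ rho + 1 <= cabs w, cabs w + half_pow R k <= T &
    y ^+ (2 ^ k) < cabs (f w)].
  elim: k => [|k [w [w1 wT yw]]].
    by exists z; rewrite [half_pow R 0]expr0 expn0 expr1 -/r /T; split.
  apply: contrapT => nw; set d := half_pow R k.+1; set X := y ^+ (2 ^ k.+1).
  have d0 : 0 < d by exact: half_pow_gt0.
  have d1 : d <= 1 by have := half_pow_le R (leq0n k.+1); rewrite [half_pow R 0]expr0.
  rewrite half_powS -/d in wT.
  have yX : y <= X by rewrite /X -[leLHS]expr1 ler_weXn2l //; [lra | rewrite expn_gt0].
  have X0 : 0 <= X by lra.
  have X1 : 1 <= X by lra.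
  (* If the next point did not exist, [X] would bound $|f|$ on the whole annulus, the inner part
     being covered by $m_0 \le y \le X$. *)
  have fX u : rho <= cabs u <= cabs w + d -> cabs (f u) <= X.
    move=> /andP[u1 u2]; have [u3|u3] := leP (cabs u) (rho + 1).
      by have := fm u ltac:(lra); lra.
    rewrite leNgt; apply/negP => uX; apply: nw; exists u; split; last exact: uX.
      by lra.
    by rewrite -/d; lra.
  have wTd : cabs w + d <= T by lra.
  have d01 : 0 < d <= 1 by rewrite d0 d1.
  have := @solution_step n s f b H rho m0 T beta K h rho1 fd feq
    (fun i => (betaP i).1) he (fun i => (betaP i).2) Hh
    (fun i => (KP i).1) (fun i => (KP i).2) fm d X w d01 X0 w1 wTd fX.
  rewrite -/(A T) -/(D T); apply/negP; rewrite -ltNge.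
  have yk0 : 0 <= y ^+ (2 ^ k) by rewrite exprn_ge0 //; lra.
  have yk1 : 1 <= y ^+ (2 ^ k) by rewrite exprn_ege1 //; lra.
  have XX : X = (y ^+ (2 ^ k)) ^+ 2 by rewrite /X expnSr exprM.
  have f1 : 1 <= cabs (f w) by lra.
  (* Here $n + 1 \ge 4$ is used: the fourth power of $y^{2^k}$ is already $X^2$. *)
  apply: lt_le_trans (_ : cabs (f w) ^+ 4 <= _); last by rewrite ler_weXn2l.
  apply: le_lt_trans (_ : X ^+ 2 < _); last first.
    by rewrite XX -exprM; apply: ltrXn2r => //; rewrite nnegrE cabs_ge0.
  have h1 : 2 * A T <= X ^+ 2.
    apply: le_trans yA _; apply: le_trans yX _.
    by rewrite expr2 ler_peMl.
  (* As $d^{-s} = (2^s)^{k+1} \le y^{k+1}$, the left side is at most $y^{k+2}$, and $k + 2 \le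
     2^{k+1}$. *)
  have h2 : 2 * D T / d ^+ s <= X.
    rewrite ler_pdivrMr ?exprn_gt0 //.
    have -> : d ^+ s = ((2 ^+ s) ^+ k.+1)^-1 by rewrite /d /half_pow -!exprM mulnC exprVn.
    rewrite ler_pdivlMr ?exprn_gt0 //.
    apply: le_trans (_ : y * y ^+ k.+1 <= _).
      apply: ler_pM => //; first by rewrite mulr_ge0.
      by apply: lerXn2r => //; rewrite nnegrE; lra.
    rewrite -exprS /X ler_weXn2l //; first by lra.
    by exact: ltn_expl.
  have -> : D T * (X / d ^+ s) = (2 * D T / d ^+ s) * X / 2 by field; rewrite gt_eqF ?exprn_gt0.
  have h3 : 2 * D T / d ^+ s * X <= X * X by rewrite ler_wpM2r.
  by rewrite expr2 in h1 *; lra.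
have [X fX] := bounded_annulus fc T.
have [N hN] : exists N : nat, Num.max X 0 < N%:R.
  by exists (Num.Def.archi_bound (Num.max X 0)); rewrite archi_boundP // le_max lexx orbT.
have [w [w1 w2 w3]] := step N; have hp := half_pow_gt0 R N.
have := fX w ltac:(lra); apply/negP; rewrite -ltNge; apply: lt_trans w3.
have XN : X < N%:R by apply: le_lt_trans hN; rewrite le_max lexx.
(* The iterates exceed $2^{2^N} \ge N > X$, against the bound [X] on the annulus up to [T]. *)
apply: lt_le_trans XN _; apply: le_trans (_ : 2 ^+ (2 ^ N) <= _).
  rewrite -natrX ler_nat; apply: leq_trans (ltnW (ltn_expl N (ltnSn 1))) _.
  by apply: ltnW; apply: ltn_expl.
by apply: lerXn2r; rewrite ?nnegrE //; lra.
Qed.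

End GrowthOfSolution.

(** * The Nevanlinna characteristic *)

Section FiniteOrder.
Variable R : realType.
Local Notation C := R[i].
Implicit Types (z w : C) (f : C -> C).

Local Open Scope ereal_scope.

(** The comparison is made between the suprema over simple minorants that define the two integrals,
    so it applies directly to the integrands of $m(r, f)$ and $N(r, f)$. *)
Lemma integral_le_cst (a b B : R) (g : R -> R) : (a <= b)%R ->
  (forall x, (a <= x <= b)%R -> (0 <= g x <= B)%R) ->
  (\int[lebesgue_measure]_(x in `[a, b]) (g x) <= B * (b - a))%R.
Proof.
move=> ab gB.
have B0 : (0 <= B)%R by have := gB a; lra.
have g0 x : `[a, b] x -> 0 <= (g x)%:E.
  by rewrite /= in_itv /= => /gB /andP[h _]; rewrite lee_fin.
have i0 : 0 <= \int[lebesgue_measure]_(x in `[a, b]) (g x)%:E by exact: integral_ge0.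
have i1 : \int[lebesgue_measure]_(x in `[a, b]) (g x)%:E <= (B * (b - a))%:E.
  have -> : (B * (b - a))%:E = \int[lebesgue_measure]_(x in `[a, b]) (cst B%:E x).
    rewrite integral_cst //= lebesgue_measure_itv /= lte_fin lt_neqAle ab andbT.
    by have [->|_] /= := eqVneq a b; rewrite ?subrr ?mulr0 ?mule0 // EFinM EFinB.
  rewrite [leRHS]ge0_integralE; last by move=> x _; rewrite lee_fin.
  rewrite ge0_integralE //; apply: le_ereal_sup => _ [h hg <-]; exists h => // x.
  apply: le_trans (hg x) _; rewrite /patch; case: ifPn => // /set_mem /=.
  by rewrite in_itv /= => /gB /andP[_ h']; rewrite lee_fin.
rewrite /Rintegral -lee_fin fineK // ge0_fin_numE //.
by apply: le_lt_trans i1 _; rewrite ltry.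
Qed.

Local Close Scope ereal_scope.

Lemma pole_countE f (s : seq C) : uniq s -> [set z | pole f z] = [set` s] ->
  forall r, pole_count f r = \sum_(z <- s | cabs z <= r) (pole_mult f z)%:R.
Proof.
move=> us ps r; rewrite /pole_count (fsbigE [seq z <- s | cabs z <= r]).
- rewrite big_filter_cond; apply: eq_bigl => z; apply/andP/idP => [[]//|zr].
  by split=> //; rewrite inE.
- exact: filter_uniq.
- by move=> z /=; rewrite mem_filter => /andP[].
- move=> z /= zr; rewrite mem_filter [cabs z <= r]zr /= => zs.
  (* Away from the poles the set of orders is empty and [xget] returns its default 0. *)
  rewrite /pole_mult xgetPN // => k hk.
  have : [set z | pole f z] z by exists k.
  by rewrite ps /= (negPf zs).
Qed.

(** With [rho] below the moduli of all nonzero poles, the integrand vanishes on $[0, \rho)$ and is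
    at most $c/\rho$ beyond, where [c] is the total multiplicity; a pole at 0 adds at most $c \ln r
    \le c r$. *)
Lemma counting_function_le f : finite_set [set z | pole f z] ->
  exists c : R, 0 <= c /\ forall r, 1 <= r -> counting_function f r <= c * r.
Proof.
move=> /finite_seqP [s0 ps0].
have us := undup_uniq s0; set s := undup s0 in us.
have ps : [set z | pole f z] = [set` s].
  by rewrite ps0; apply/seteqP; split=> z /=; rewrite mem_undup.
have pcE := pole_countE us ps.
clear ps ps0 us.
have [rho [rho0 hrho]] : exists rho : R, 0 < rho /\ forall z, z \in s -> z != 0 -> rho <= cabs z.
  elim: (s) => [|x t [rho [rho0 H]]]; first by exists 1.
  have [x0|x0] := eqVneq x 0.
    by exists rho; split=> // z; rewrite inE => /orP[/eqP->|/H //]; rewrite x0 eqxx.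
  exists (Num.min rho (cabs x)); split; first by rewrite lt_min rho0 cabs_gt0.
  move=> z; rewrite inE ge_min => /orP[/eqP-> _|/H h /h ->] //.
  by rewrite lexx orbT.
pose m z : R := (pole_mult f z)%:R.
have m0 z : 0 <= m z by exact: ler0n.
pose c := \sum_(z <- s) m z.
have c0 : 0 <= c by apply: sumr_ge0.
have pc_ge0 r : 0 <= pole_count f r by rewrite pcE; apply: sumr_ge0.
have pc_le r : pole_count f r <= c.
  rewrite pcE big_mkcond; apply: ler_sum => z _; case: ifP => // _; exact: m0.
have pc_mon r : 0 <= r -> pole_count f 0 <= pole_count f r.
  move=> r0; rewrite !pcE big_mkcond [leRHS]big_mkcond; apply: ler_sum => z _.
  have [z0|z0] := leP (cabs z) 0; first by rewrite (le_trans z0).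
  by case: ifP => // _; exact: m0.
have pc_small r : 0 <= r < rho -> pole_count f r = pole_count f 0.
  move=> /andP[r0 rr]; rewrite !pcE big_seq_cond [RHS]big_seq_cond; apply: eq_bigl => z.
  have [zs|] //= := boolP (z \in s); have [->|z0] := eqVneq z 0; first by rewrite cabs0 r0 lexx.
  have := hrho z zs z0 => h.
  have -> : (cabs z <= r) = false by apply/negP => ?; lra.
  by apply/esym/negP => ?; lra.
exists (c / rho + c); split; first by rewrite addr_ge0 // divr_ge0 // ltW.
move=> r r1; rewrite /counting_function mulrDl; apply: lerD.
  have -> : c / rho * r = c / rho * (r - 0) by rewrite subr0.
  apply: integral_le_cst => [|x /andP[x0 xr]]; first by lra.
  have [xrho|xrho] := ltP x rho.
    by rewrite pc_small ?x0 // subrr mul0r lexx divr_ge0 // ltW.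
  have xp : 0 < x by lra.
  apply/andP; split; first by rewrite divr_ge0 // subr_ge0 pc_mon.
  apply: ler_pM; rewrite ?subr_ge0 ?pc_mon ?invr_ge0 //.
    by have := pc_le x; have := pc_ge0 0; lra.
  by rewrite lef_pV2 ?posrE.
apply: ler_pM => //; first by rewrite ln_ge0.
by apply/ltW/ln_sublinear; lra.
Qed.

Lemma proximity_function_le f (r M : R) : 0 <= r -> 0 <= M ->
  (forall z, cabs z = r -> cabs (f z) <= expR M) -> proximity_function f r <= M.
Proof.
move=> r0 M0 fM; have pi0 := pi_gt0 R; rewrite /proximity_function.
rewrite mulrC ler_pdivrMr; last by rewrite mulr_gt0.
have -> : M * (2 * pi) = M * (2 * pi - 0) by rewrite subr0.
apply: integral_le_cst => [|x _]; first by rewrite mulr_ge0 // ltW.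
set z := _ * _; have /fM zM : cabs z = r.
  by rewrite /z cabsM cabs_real cabs_cexp /= expR0 mulr1 ger0_norm.
rewrite /logp le_max lexx /= ge_max M0 /=.
have [f0|f0] := leP (cabs (f z)) 0; first by rewrite ln0.
by rewrite -[leRHS]expRK ler_ln // posrE expR_gt0.
Qed.

Lemma finite_order_of_dominated f (rho : R) : 1 <= rho -> dominated rho f ->
  finite_set [set z | pole f z] -> finite_order f.
Proof.
move=> rho1 [phi [_ _ [A [k [A0 pA]]]] fphi] /counting_function_le [c [c0 Nf]].
(* The added 1 ensures $\ln D \ge 0$. *)
pose D := A + c + 1; have D1 : 1 <= D by rewrite /D; lra.
have Tf r : rho <= r -> nevanlinna_char f r <= D * r ^+ k.+1.
  move=> hr; have r1 : 1 <= r by lra.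
  have r0 : 0 <= r by lra.
  have h1 : proximity_function f r <= A * r ^+ k.+1.
    apply: proximity_function_le => //; first by rewrite mulr_ge0 // exprn_ge0.
    move=> z zr; apply: le_trans (fphi z _) _; first by rewrite zr.
    rewrite zr (le_trans (pA _ r1)) // ler_expR ler_wpM2l // ler_weXn2l //.
  have h2 : c * r <= c * r ^+ k.+1 by rewrite ler_wpM2l // -[leLHS]expr1 ler_weXn2l.
  have := Nf r r1; have : 0 <= r ^+ k.+1 by rewrite exprn_ge0.
  by rewrite /nevanlinna_char /D; lra.
have bound : (growth_order f <= (ln D + k.+1%:R)%:E)%E.
  apply: ereal_inf_le; exists (ereal_sup [set (ln (nevanlinna_char f r) / ln r)%:E
     | r in [set r | Num.max rho (expR 1) < r]]).
    (* Beyond $e$ one has $\ln r > 1$, so $\ln D \le \ln D \ln r$ and the quotient is at most $\ln D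
       + k + 1$. *)
    exists [set r | Num.max rho (expR 1) < r] => //.
    by exists (Num.max rho (expR 1)); split; [exact: num_real | ].
  apply: ge_ereal_sup => y [r hr <-]; move: hr => /=; rewrite gt_max => /andP[rr er].
  rewrite lee_fin.
  have rp : 0 < r by lra.
  have ln1 : 1 < ln r by rewrite -[ltLHS]expRK ltr_ln // posrE expR_gt0.
  have lnD : 0 <= ln D by rewrite ln_ge0.
  rewrite ler_pdivrMr; last by lra.
  have k0 : 0 <= k.+1%:R :> R by exact: ler0n.
  have rhs : ln D + k.+1%:R * ln r <= (ln D + k.+1%:R) * ln r.
    rewrite mulrDl; have : ln D * 1 <= ln D * ln r by rewrite ler_wpM2l // ltW.
    by lra.
  (* [ln] is 0 at nonpositive arguments. *)
  apply: le_trans rhs; have [T0|T0] := leP (nevanlinna_char f r) 0.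
    by rewrite ln0 // addr_ge0 // mulr_ge0 //; lra.
  have -> : ln D + k.+1%:R * ln r = ln (D * r ^+ k.+1).
    rewrite lnM ?posrE ?exprn_gt0 //; last by lra.
    by rewrite lnXn // mulr_natl.
  rewrite ler_ln ?posrE //; first by apply: Tf; lra.
  by rewrite mulr_gt0 ?exprn_gt0 //; lra.
by apply: le_lt_trans bound _; rewrite ltry.
Qed.

End FiniteOrder.

(** * Exponential polynomials *)

Section ExponentialPolynomials.
Variable R : realType.
Local Notation C := R[i].
Implicit Types (z w h : C) (p q d u v t : {poly C}) (l : seq ({poly C} * {poly C})).

Lemma cexpD z w : cexp (z + w) = cexp z * cexp w.
Proof.
case: z w => a b [c d]; rewrite /cexp /= expRD cosD sinD.
by apply/eqP; rewrite eq_complex /=; apply/andP; split; apply/eqP; ring.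
Qed.

Lemma cexp0 : cexp (0 : C) = 1.
Proof. by rewrite /cexp /= expR0 cos0 sin0 mulr1 mulr0. Qed.

Lemma cexp_neq0 z : cexp z != 0.
Proof. by rewrite -cabs_gt0 cabs_cexp expR_gt0. Qed.

Lemma cexpX z n : cexp z ^+ n = cexp (n%:R * z).
Proof.
elim: n => [|n IH]; first by rewrite mul0r cexp0.
by rewrite exprS IH -cexpD -natr1 mulrDl mul1r addrC.
Qed.

Lemma is_derive_small (g : R -> R) (x l : R) : is_derive x 1 g l ->
  forall e, 0 < e -> exists2 d : R, 0 < d &
    forall y, `|y| < d -> `|g (x + y) - g x - l * y| <= e * `|y|.
Proof.
move=> [/derivableP[gd gl] gl'] e e0.
have cv : (fun h : R => h^-1 *: (g (h *: 1 + x) - g x)) @ 0^' --> l.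
  by rewrite -gl'; exact: gd.
move/cvgrPdist_le: cv => /(_ e e0) /nbhs_ballP [d /= d0 H].
exists d => // y yd; have [->|y0] := eqVneq y 0.
  by rewrite addr0 subrr mulr0 subr0 normr0 mulr0.
have := H y; rewrite /ball /= sub0r normrN => /(_ yd y0).
have -> : g (x + y) - g x - l * y = - (l - y^-1 *: (g (y *: 1 + x) - g x)) * y.
  rewrite (_ : y *: 1 = y); last by rewrite /GRing.scale /= mulr1.
  by rewrite (addrC y x) /GRing.scale /=; field.
by rewrite normrM normrN => h; rewrite ler_wpM2r.
Qed.

Lemma cdiff_cexp0 : cdiff (@cexp R) 0 1.
Proof.
move=> e e0.
(* Real and imaginary parts each have an error of at most $3 e_1 |w|$, in total less than $e|w|$;
   requiring $|w| < e_1/2$ takes care of the product $(e^x - 1)y$. *)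
pose e1 := Num.min 1 (e / 8); have e10 : 0 < e1 by rewrite lt_min ltr01 divr_gt0.
have e11 : e1 <= 1 by rewrite ge_min lexx.
have e18 : e1 <= e / 8 by rewrite ge_min lexx orbT.
have [d1 d10 H1] := is_derive_small (is_derive_expR (0 : R)) e10.
have [d2 d20 H2] := is_derive_small (is_derive_cos (0 : R)) e10.
have [d3 d30 H3] := is_derive_small (is_derive_sin (0 : R)) e10.
exists (Num.min (Num.min d1 d2) (Num.min d3 (e1 / 2))).
  by rewrite !lt_min d10 d20 d30 divr_gt0.
move=> w; rewrite !lt_min !subr0 cexp0 -!andbA => /and4P[wd1 wd2 wd3 wd4].
rewrite mul1r; have := Re_le_cabs w; have := Im_le_cabs w.
move: wd1 wd2 wd3 wd4; set W := cabs w; case: w @W => x y W wd1 wd2 wd3 wd4 hy hx.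
rewrite [complex.Im _]/= in hy; rewrite [complex.Re _]/= in hx.
have := H1 x; have := H2 y; have := H3 y.
rewrite !add0r expR0 cos0 sin0 oppr0 mul0r !subr0 !mul1r ?addr0.
move=> /(_ ltac:(lra)) h3 /(_ ltac:(lra)) h2 /(_ ltac:(lra)) h1.
apply: le_trans (cabs_le_ReIm _) _; rewrite /cexp /=.
set E := expR x in h1 *; set c := cos y in h2 *; set s := sin y in h3 *.
rewrite oppr0 addr0.
have W0 : 0 <= W by exact: cabs_ge0.
have a1 : `|E - 1 - x| <= e1 * W by rewrite (le_trans h1) // ler_wpM2l // ltW.
have a2 : `|c - 1| <= e1 * W by rewrite (le_trans h2) // ler_wpM2l // ltW.
have a3 : `|s - y| <= e1 * W by rewrite (le_trans h3) // ler_wpM2l // ltW.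
have W2 : W <= 1 / 2 by lra.
have eW : e1 * W <= W by rewrite ler_piMl.
have a4 : `|E - 1| <= 2 * W.
  by have := ler_normD (E - 1 - x) x; rewrite subrK; lra.
have a5 : `|E| <= 2 by have := ler_normD (E - 1) 1; rewrite subrK normr1; lra.
have b1 : `|E * c - 1 - x| <= 3 * (e1 * W).
  have -> : E * c - 1 - x = (E - 1 - x) + E * (c - 1) by ring.
  apply: le_trans (ler_normD _ _) _; rewrite normrM.
  have : `|E| * `|c - 1| <= 2 * (e1 * W) by rewrite ler_pM.
  by lra.
have b2 : `|E * s - y| <= 3 * (e1 * W).
  have -> : E * s - y = E * (s - y) + (E - 1) * y by ring.
  apply: le_trans (ler_normD _ _) _; rewrite !normrM.
  have : `|E| * `|s - y| <= 2 * (e1 * W) by rewrite ler_pM.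
  have : `|E - 1| * `|y| <= (2 * W) * W by rewrite ler_pM.
  have : 2 * W * W <= e1 * W by rewrite ler_wpM2r //; lra.
  by lra.
have : e1 * W <= e / 8 * W by rewrite ler_wpM2r.
have : 0 <= e * W by rewrite mulr_ge0 // ltW.
by lra.
Qed.

Lemma cdiff_cexp z : cdiff (@cexp R) z (cexp z).
Proof.
have hs : cdiff (fun w => w - z) z 1.
  by rewrite -[1]subr0; apply: cdiffB (cdiff_id z) (cdiff_cst z z).
have := cdiff_comp hs; rewrite subrr => /(_ _ _ cdiff_cexp0) /(cdiffZ (cexp z)).
rewrite !mulr1; apply: cdiff_local ltr01 _ => w _.
by rewrite -cexpD addrC subrK.
Qed.

Lemma cdiff_horner p z : cdiff (horner p) z (deriv p).[z].
Proof.
elim/poly_ind: p => [|p c IH].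
  rewrite deriv0 horner0; apply: cdiff_local ltr01 _ (cdiff_cst 0 z) => w _.
  by rewrite horner0.
have := cdiffD (cdiffM IH (cdiff_id z)) (cdiff_cst c z).
rewrite addr0 derivD derivM derivC derivX addr0 mulr1 hornerD hornerMX mulr1.
by apply: cdiff_local ltr01 _ => w _; rewrite hornerD hornerMX hornerC.
Qed.

Lemma cdiff_cexp_horner p z : cdiff (fun w => cexp p.[w]) z (cexp p.[z] * (deriv p).[z]).
Proof. exact: cdiff_comp (cdiff_horner p z) (cdiff_cexp _). Qed.

(** Otherwise [p * d] would be a nonzero polynomial that vanishes everywhere. *)
Lemma poly_eq0_off p d : d != 0 -> (forall z, d.[z] != 0 -> p.[z] = 0) -> p = 0.
Proof.
move=> d0 H; apply/eqP; apply/negPn/negP => p0.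
have pd0 : p * d != 0 by rewrite mulf_neq0.
have [rho [a [r1 a0 lo]]] := poly_lower pd0.
have := lo rho%:C; rewrite cabs_real ger0_norm ?(le_trans ler01) // => /(_ (lexx _)).
rewrite hornerM; have [->|h] := eqVneq d.[rho%:C] 0.
  by rewrite mulr0 cabs0 leNgt a0.
by rewrite H // mul0r cabs0 leNgt a0.
Qed.

Lemma horner_neq0_near d z : d.[z] != 0 -> exists2 e : R, 0 < e &
  forall w, cabs (w - z) < e -> d.[w] != 0.
Proof.
move=> dz; have e0 : 0 < cabs d.[z] / 2 by rewrite divr_gt0 // cabs_gt0.
have [e h H] := cdiff_cont (cdiff_horner d z) e0; exists e => // w /H.
have := cabs_gt0 d.[z]; rewrite dz => dp.
apply: contraTneq => ->; rewrite sub0r cabsN -ltNge; lra.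
Qed.

Definition expoly l z : C := \sum_(s <- l) s.1.[z] * cexp s.2.[z].

Definition expoly_deriv l := [seq (deriv s.1 + deriv s.2 * s.1, s.2) | s <- l].

Lemma cdiff_expoly l z : cdiff (expoly l) z (expoly (expoly_deriv l) z).
Proof.
elim: l => [|s l IH].
  rewrite /expoly big_nil; apply: cdiff_local ltr01 _ (cdiff_cst 0 z) => w _.
  by rewrite big_nil.
have := cdiffD (cdiffM (cdiff_horner s.1 z) (cdiff_cexp_horner s.2 z)) IH.
rewrite [in X in _ -> X]/expoly /expoly_deriv /= big_cons -/(expoly_deriv l) /=.
rewrite -/(expoly (expoly_deriv l) z) hornerD hornerM.
have -> : (deriv s.1).[z] * cexp s.2.[z] + s.1.[z] * (cexp s.2.[z] * (deriv s.2).[z]) =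
   ((deriv s.1).[z] + (deriv s.2).[z] * s.1.[z]) * cexp s.2.[z] by ring.
by apply: cdiff_local ltr01 _ => w _; rewrite /expoly big_cons.
Qed.

Lemma expoly_deriv_eq0 l d : (forall z, d.[z] != 0 -> expoly l z = 0) ->
  forall z, d.[z] != 0 -> expoly (expoly_deriv l) z = 0.
Proof.
move=> H z /horner_neq0_near [e e0 He].
apply: cdiff_uniq (cdiff_expoly l z) _.
by apply: cdiff_local e0 _ (cdiff_cst 0 z) => w /He /H ->.
Qed.

(** The termwise action of $F \mapsto e^v (e^{-v} F)'$ on $p e^q$: a term with $q = v$ has its
    coefficient differentiated. *)
Definition twist v (s : {poly C} * {poly C}) := (deriv s.1 + deriv (s.2 - v) * s.1, s.2).

Lemma twist_eq0 l d v : (forall z, d.[z] != 0 -> expoly l z = 0) ->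
  forall z, d.[z] != 0 -> expoly (map (twist v) l) z = 0.
Proof.
move=> H z dz; have h1 := expoly_deriv_eq0 H dz; have h2 := H z dz.
transitivity (expoly (expoly_deriv l) z - (deriv v).[z] * expoly l z); last first.
  by rewrite h1 h2 mulr0 subr0.
rewrite /expoly !big_map mulr_sumr -sumrB; apply: eq_bigr => s _ /=.
by rewrite derivB !(hornerD, hornerM, hornerN); ring.
Qed.

(** A nonzero $p$ has larger degree than $p'$, while the degree of $(q-v)'p$ is at least that of
    $p$, so the two cannot cancel. *)
Lemma twist_inj p q v : deriv (q - v) != 0 -> (twist v (p, q)).1 = 0 -> p = 0.
Proof.
move=> d0 /= /eqP; rewrite addr_eq0 => /eqP E; apply/eqP; apply/negPn/negP => p0.
have h1 : (size (deriv p) < size p)%N by exact: lt_size_deriv.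
have : (size p <= size (deriv (q - v) * p)%R)%N.
  rewrite size_mul //; move: d0; rewrite -size_poly_gt0; case: (size (deriv _)) => // m _.
  by rewrite addSn /= leq_addl.
by rewrite -(size_polyN (_ * _)) -E leqNgt h1.
Qed.

(* Twisting by the exponent of the second term lowers the degree of its coefficient and
   preserves the nonvanishing of the first, which eliminates the terms one by one. *)
Lemma expoly_indep l p q d : d != 0 -> (forall s, s \in l -> deriv s.2 != deriv q) ->
  (forall z, d.[z] != 0 -> expoly ((p, q) :: l) z = 0) -> p = 0.
Proof.
move=> d0; move: {2}(size l) (erefl (size l)) => m.
elim: m l p => [|m IHm] [|[p1 q1] l] p //=.
  move=> _ _ H; apply: (poly_eq0_off d0) => z /H.
  rewrite /expoly big_cons big_nil addr0 /= => /eqP.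
  by rewrite mulf_eq0 (negPf (cexp_neq0 _)) orbF => /eqP.
move=> [sl]; move: {2}(size p1).+1 (ltnSn (size p1)) => N.
elim: N p1 l p sl => // N IHN p1 l p sl p1N hq H.
have q10 : deriv (q - q1) != 0.
  by rewrite derivB subr_eq0 eq_sym; apply: (hq (p1, q1)); rewrite mem_head.
have hql s : s \in l -> deriv s.2 != deriv q by move=> sl'; apply: hq; rewrite inE sl' orbT.
have [p10|p10] := eqVneq p1 0.
  apply: IHm sl hql _ => z /H; rewrite /expoly !big_cons /= p10 horner0 mul0r add0r.
  exact: id.
apply: (twist_inj q10); apply: (IHN (twist q1 (p1, q1)).1 (map (twist q1) l)).
- by rewrite size_map.
- rewrite /= subrr deriv0 mul0r addr0; apply: leq_trans (lt_size_deriv p10) _.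
  by rewrite -ltnS.
- move=> s; rewrite inE => /orP[/eqP -> /=|/mapP [s' /hql h ->] //].
  by apply: (hq (p1, q1)); rewrite mem_head.
- move=> z dz; exact: (twist_eq0 q1 H dz).
Qed.

End ExponentialPolynomials.

(** * Excluding the exponential form, and assembling the growth bound *)

Section ExponentialForm.
Variable R : realType.
Local Notation C := R[i].
Implicit Types (z w : C) (p q d u t : {poly C}) (r : C -> C).

(** Rational functions with poles among the zeros of a fixed [d]. Values at these zeros stay free,
    since division by 0 makes them meaningless. *)
Definition rational_off d r := exists N u, forall z, d.[z] != 0 ->
  r z * d.[z] ^+ N = u.[z].

Lemma rational_off_poly d p : rational_off d (horner p).
Proof. by exists 0%N, p => z _; rewrite expr0 mulr1. Qed.

Lemma rational_offD d r r' : rational_off d r -> rational_off d r' ->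
  rational_off d (fun z => r z + r' z).
Proof.
move=> [N [u H]] [N' [u' H']]; exists (N + N')%N, (u * d ^+ N' + u' * d ^+ N) => z dz.
rewrite hornerD !hornerM !horner_exp -H // -H' // exprD; ring.
Qed.

Lemma rational_offM d r r' : rational_off d r -> rational_off d r' ->
  rational_off d (fun z => r z * r' z).
Proof.
move=> [N [u H]] [N' [u' H']]; exists (N + N')%N, (u * u') => z dz.
rewrite hornerM -H // -H' // exprD; ring.
Qed.

Lemma rational_offX d r k : rational_off d r -> rational_off d (fun z => r z ^+ k).
Proof.
move=> [N [u H]]; exists (N * k)%N, (u ^+ k) => z dz.
by rewrite horner_exp -H // exprMn exprM.
Qed.

Lemma rational_off_sum d (J : Type) (s : seq J) (F : J -> C -> C) :
  (forall i, rational_off d (F i)) -> rational_off d (fun z => \sum_(i <- s) F i z).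
Proof.
move=> FR; elim: s => [|i s [N [u H]]].
  by exists 0%N, 0 => z _; rewrite big_nil mul0r horner0.
have [N' [u' H']] := rational_offD (FR i) (ex_intro _ N (ex_intro _ u H)).
by exists N', u' => z dz; rewrite big_cons -H'.
Qed.

Lemma rational_off_inv d q : q %| d -> rational_off d (fun z => q.[z]^-1).
Proof.
move=> qd; exists 1%N, (d %/ q) => z; rewrite expr1 -{1 2}(divpK qd) hornerM.
by rewrite mulf_eq0 negb_or => /andP[_ qz]; rewrite mulrCA mulVf // mulr1.
Qed.

Lemma rational_off_ratio d p q : q %| d -> rational_off d (fun z => p.[z] / q.[z]).
Proof. by move=> qd; apply: rational_offM (rational_off_poly d p) (rational_off_inv qd). Qed.

Lemma eq_rational_off d r r' : (forall z, d.[z] != 0 -> r z = r' z) ->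
  rational_off d r -> rational_off d r'.
Proof. by move=> E [N [u H]]; exists N, u => z dz; rewrite -E // H. Qed.

(** A single exponent for the whole family, so that one multiplication by $d^N$ clears all
    denominators of a linear relation. *)
Lemma rational_off_common d (J : finType) (F : J -> C -> C) :
  (forall i, rational_off d (F i)) ->
  exists N (u : J -> {poly C}), forall i z, d.[z] != 0 -> F i z * d.[z] ^+ N = (u i).[z].
Proof.
move=> /choice [N /choice [u H]].
exists (\sum_i N i)%N, (fun i => u i * d ^+ (\sum_(j | j != i) N j)) => i z dz.
by rewrite (bigD1 i) //= exprD mulrA H // hornerM horner_exp.
Qed.

Lemma cdiff_not_pole r z l : cdiff r z l -> ~ pole r z.
Proof.
move=> /cdiff_cont /(_ 1 ltr01) [e e0 H].
apply: (@bounded_not_pole _ r z (cabs (r z) + 1) e) => // w /H.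
by have := cabs_revB (r w) (r z); lra.
Qed.

Lemma cdiff_ratio p q z : q.[z] != 0 -> exists l, cdiff (fun w => p.[w] / q.[w]) z l.
Proof.
move=> qz; eexists; apply: cdiffM (cdiff_horner p z) _.
exact: cdiff_comp (cdiff_horner q z) (cdiff_inv qz).
Qed.

Lemma derive1n_exp_form r p q t d : (forall z, d.[z] != 0 -> q.[z] != 0) ->
  (forall z, d.[z] != 0 -> r z = p.[z] / q.[z] * cexp t.[z]) ->
  forall i, exists u, forall z, d.[z] != 0 ->
    derive1n i r z = u.[z] / q.[z] ^+ i.+1 * cexp t.[z].
Proof.
move=> dq rE; elim=> [|i [u IH]]; first by exists p => z /rE; rewrite expr1.
(* The numerator over $q^{i+2}$ given by the product and quotient rules for $u q^{-(i+1)} e^t$. *)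
exists (deriv u * q + deriv t * u * q - i.+1%:R *: (deriv q * u)) => z dz.
have qz := dq z dz; have qi : q.[z] ^+ i.+1 != 0 by rewrite expf_neq0.
rewrite derive1nS; apply: cdiff_derive1.
have [e e0 He] := horner_neq0_near dz.
have h := cdiffM (cdiffM (cdiff_horner u z)
  (cdiff_comp (cdiffX i.+1 (cdiff_horner q z)) (cdiff_inv qi))) (cdiff_cexp_horner t z).
move: h; set l := (X in cdiff _ _ X) => h.
have -> : (deriv u * q + deriv t * u * q - i.+1%:R *: (deriv q * u)).[z] /
    q.[z] ^+ i.+2 * cexp t.[z] = l.
  rewrite /l /= !(hornerD, hornerM, hornerN, hornerZ) !exprS; field.
  by rewrite qz expf_neq0.
by apply: cdiff_local e0 _ h => w /He /IH ->.
Qed.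

(** Pigeonhole: otherwise the test against [a] would inject three indices into the booleans, the
    value [false] being taken only where the derivative is [b]. *)
Lemma unmatched_exponent (gamma : 'I_3 -> {poly C}) (a b : {poly C}) :
  injective (fun j => deriv (gamma j)) ->
  exists j, deriv (gamma j) != a /\ deriv (gamma j) != b.
Proof.
move=> inj; apply: contrapT => nj.
have cover j : deriv (gamma j) != a -> deriv (gamma j) = b.
  move=> ja; apply/eqP; apply: contrapT => /negP jb; apply: nj; exists j.
  by split.
have : injective (fun j => deriv (gamma j) == a).
  move=> i j /=; have [Ei|Ei] := eqVneq (deriv (gamma i)) a => /esym.
    by move=> /eqP Ej; apply: inj; rewrite Ei Ej.
  by move=> /negbT /cover Ej; apply: inj; rewrite Ej (cover _ Ei).
by move=> /leq_card; rewrite card_ord card_bool.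
Qed.

Lemma no_exponential_form (n s : nat) (b : 'I_s.+1 -> C -> C) (P : 'I_3 -> C -> C)
    (gamma : 'I_3 -> {poly C}) (f w : C -> C) t :
  (forall i, rational_function (b i)) -> (forall j, rational_function (P j)) ->
  (forall j, P j <> (fun=> 0)) -> injective (fun j => deriv (gamma j)) ->
  (forall z, ~ pole f z -> (forall i, ~ pole (b i) z) -> (forall j, ~ pole (P j) z) ->
     f z ^+ n * derive1 f z + lin_diff_poly b f z
       = \sum_(j < 3) P j z * cexp (gamma j).[z]) ->
  finite_set [set z | pole f z] -> rational_function w ->
  ~ mero_eq f (fun z => w z * cexp t.[z]).
Proof.
move=> br Pr P0 inj feq /finite_seqP [ps psE] [p [q [q0 _ wE]]] fw.
have /choice [bq bqE] : forall i, exists pq : {poly C} * {poly C},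
    pq.2 != 0 /\ forall z, b i z = pq.1.[z] / pq.2.[z].
  by move=> i; have [p' [q' [q'0 _ H]]] := br i; exists (p', q').
have /choice [Pq PqE] : forall j, exists pq : {poly C} * {poly C},
    pq.2 != 0 /\ forall z, P j z = pq.1.[z] / pq.2.[z].
  by move=> j; have [p' [q' [q'0 _ H]]] := Pr j; exists (p', q').
pose dp : {poly C} := \prod_(x <- ps) ('X - x%:P).
pose db := \prod_i (bq i).2; pose dP := \prod_j (Pq j).2.
(* Off the zeros of [d] all coefficients are regular and [f] has no pole, so both the equation and
   the representation hold pointwise. *)
pose d := q * dp * db * dP.
have d0 : d != 0.
  rewrite !mulf_neq0 //.
  - by rewrite /dp prodf_seq_neq0; apply/allP => x _ /=; rewrite polyXsubC_eq0.
  - by apply/prodf_neq0 => i _; case: (bqE i).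
  - by apply/prodf_neq0 => j _; case: (PqE j).
have qd : q %| d by rewrite /d -!mulrA dvdp_mulIl.
have bd i : (bq i).2 %| d.
  by apply: dvdp_mulr; apply: dvdp_mull; rewrite /db (bigD1 i) //= dvdp_mulIl.
have Pd j : (Pq j).2 %| d by apply: dvdp_mull; rewrite /dP (bigD1 j) //= dvdp_mulIl.
have dvd_neq0 u z : u %| d -> d.[z] != 0 -> u.[z] != 0.
  by move=> ud; rewrite -(divpK ud) hornerM mulf_eq0 negb_or => /andP[].
have fnp z : d.[z] != 0 -> ~ pole f z.
  move=> dz pz; have zs : z \in ps by have : [set z | pole f z] z by []; rewrite psE.
  have zd : ('X - z%:P) %| d.
    do 2! apply: dvdp_mulr; apply: dvdp_mull.
    by rewrite /dp (big_rem z) //= dvdp_mulIl.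
  by have := dvd_neq0 _ _ zd dz; rewrite hornerXsubC subrr eqxx.
have rnp (r : C -> C) u v z : (forall z, r z = u.[z] / v.[z]) -> v %| d -> d.[z] != 0 -> ~ pole r z.
  move=> rE vd dz; have [l hl] := cdiff_ratio u (dvd_neq0 _ _ vd dz).
  by apply: (@cdiff_not_pole _ _ l); apply: cdiff_local ltr01 _ hl => x _.
have fE z : d.[z] != 0 -> f z = p.[z] / q.[z] * cexp t.[z].
  move=> dz; rewrite -wE; apply: fw; first exact: fnp.
  have [l hl] := cdiff_ratio p (dvd_neq0 _ _ qd dz).
  apply: (@cdiff_not_pole _ _ (l * cexp t.[z] + p.[z] / q.[z] * (cexp t.[z] * (deriv t).[z]))).
  apply: cdiff_local ltr01 _ (cdiffM hl (cdiff_cexp_horner t z)) => x _.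
  by rewrite wE.
have /choice [u uE] := derive1n_exp_form (fun z => dvd_neq0 _ z qd) fE.
(* [A] and [Q] are the coefficients of $e^{(n+1)t}$ and $e^t$ after substitution: the first comes
   from $f^n f'$, the second from the linear part. *)
pose A z := (p.[z] / q.[z]) ^+ n * ((u 1%N).[z] * q.[z]^-1 ^+ 2).
pose Q z := \sum_(i < s.+1) (bq i).1.[z] / (bq i).2.[z] * ((u i).[z] * q.[z]^-1 ^+ i.+1).
pose tA := n.+1%:R *: t.
have relation z : d.[z] != 0 ->
    A z * cexp tA.[z] + Q z * cexp t.[z] = \sum_(j < 3) P j z * cexp (gamma j).[z].
  move=> dz; rewrite -feq; first last.
  - by move=> j; case: (PqE j) => _ /rnp; apply.
  - by move=> i; case: (bqE i) => _ /rnp; apply.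
  - exact: fnp.
  congr (_ + _).
    have := uE 1%N z dz; rewrite derive1n1 => ->.
    rewrite fE // /A /tA hornerZ -cexpX [q.[z]^-1 ^+ 2]exprVn.
    set x := p.[z] / _; set y := (_ ^+ 2)^-1; set e := cexp _.
    by clearbody x y e; rewrite exprMn exprSr; ring.
  rewrite /Q /lin_diff_poly mulr_suml; apply: eq_bigr => i _.
  by case: (bqE i) => _ ->; rewrite uE // exprVn; ring.
have [j0 [ja jb]] := unmatched_exponent (deriv tA) (deriv t) inj.
(* The five coefficients as one finite family, to be given a common denominator. *)
pose F (k : option (option 'I_3)) : C -> C :=
  match k with None => A | Some None => Q | Some (Some j) => P j end.
have FR k : rational_off d (F k).
  have qinv := rational_off_inv qd.
  case: k => [[j|]|] /=.
  - apply: eq_rational_off (rational_off_ratio (Pq j).1 (Pd j)) => z _.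
    by case: (PqE j) => _ ->.
  - apply: rational_off_sum => i; apply: rational_offM; first exact: rational_off_ratio.
    by apply: rational_offM; [exact: rational_off_poly | exact: rational_offX].
  - apply: rational_offM; first by apply: rational_offX; exact: rational_off_ratio.
    by apply: rational_offM; [exact: rational_off_poly | exact: rational_offX].
have [N [v vE]] := rational_off_common FR.
(* All terms but that of [j0], moved to one side. [expoly_indep] compares each of their exponents
   only with [gamma j0], so [tA] or [t] may coincide with another [gamma j]. *)
pose l := (- v None, tA) :: (- v (Some None), t) ::
  [seq (v (Some (Some j)), gamma j) | j <- enum (predC1 j0)].
have v0 : v (Some (Some j0)) = 0.
  apply: (@expoly_indep _ l _ (gamma j0) d d0).
    move=> x; rewrite !inE => /or3P[/eqP->|/eqP->|/mapP[j]] /=; rewrite 1?eq_sym //.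
    by rewrite mem_enum inE => jj0 -> /=; apply: contra jj0 => /eqP /inj ->.
  move=> z dz; rewrite /expoly !big_cons big_map big_enum /= !hornerN.
  rewrite -!(vE None, vE (Some None), vE (Some (Some j0))) //=.
  have -> : \sum_(j in predC1 j0) (v (Some (Some j))).[z] * cexp (gamma j).[z] =
      (\sum_(j in predC1 j0) P j z * cexp (gamma j).[z]) * d.[z] ^+ N.
    by rewrite mulr_suml; apply: eq_bigr => j _; rewrite -vE //=; ring.
  have := relation z dz; rewrite [in X in X -> _](bigD1 j0) //= => rel.
  transitivity ((P j0 z * cexp (gamma j0).[z] +
    \sum_(i < 3 | i != j0) P i z * cexp (gamma i).[z] -
    (A z * cexp tA.[z] + Q z * cexp t.[z])) * d.[z] ^+ N); first by ring.
  by rewrite rel subrr mul0r.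
(* Clearing denominators gives $P_{j_0} = 0$ off the zeros of [d]; hence its numerator is the zero
   polynomial and [P j0] vanishes everywhere. *)
apply: (P0 j0); apply/funext => z; case: (PqE j0) => r0 rE; rewrite rE.
suff -> : (Pq j0).1 = 0 by rewrite horner0 mul0r.
apply: (poly_eq0_off d0) => y dy; have := vE (Some (Some j0)) y dy; rewrite v0 horner0 /= rE.
move=> /eqP; rewrite !mulf_eq0 invr_eq0 (negPf (dvd_neq0 _ _ (Pd j0) dy)) orbF.
by rewrite expf_eq0 (negPf dy) andbF orbF => /eqP.
Qed.

Lemma solution_dominated (n s : nat) (b : 'I_s.+1 -> C -> C) (P : 'I_3 -> C -> C)
    (gamma : 'I_3 -> {poly C}) (f : C -> C) : (3 <= n)%N ->
  (forall i, rational_function (b i)) -> (forall j, rational_function (P j)) ->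
  meromorphic f ->
  (forall z, ~ pole f z -> (forall i, ~ pole (b i) z) -> (forall j, ~ pole (P j) z) ->
     f z ^+ n * derive1 f z + lin_diff_poly b f z
       = \sum_(j < 3) P j z * cexp (gamma j).[z]) ->
  finite_set [set z | pole f z] -> exists2 rho : R, 1 <= rho & dominated rho f.
Proof.
move=> n3 br Pr fm feq /finite_seqP [ps psE].
have /choice [rb rbP] := fun i => rational_at_infinity (br i).
have /choice [rP rPP] := fun j => rational_at_infinity (Pr j).
pose Sp := \sum_(x <- ps) cabs x; pose Sb := \sum_i rb i; pose SP := \sum_j rP j.
have Sp0 : 0 <= Sp by apply: sumr_ge0 => *; exact: cabs_ge0.
have rb0 i : 0 <= rb i by case: (rbP i) => h _ _; exact: le_trans h.
have rP0 j : 0 <= rP j by case: (rPP j) => h _ _; exact: le_trans h.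
have Sb0 : 0 <= Sb by apply: sumr_ge0.
have SP0 : 0 <= SP by apply: sumr_ge0.
have rbS i : rb i <= Sb by rewrite /Sb (bigD1 i) //= lerDl sumr_ge0.
have rPS j : rP j <= SP by rewrite /SP (bigD1 j) //= lerDl sumr_ge0.
have pole_small z : pole f z -> cabs z <= Sp.
  move=> pz; have zs : z \in ps by have : [set z | pole f z] z by []; rewrite psE.
  by rewrite /Sp (big_rem z) //= lerDl sumr_ge0 // => *; exact: cabs_ge0.
(* Summing instead of maximising yields a radius beyond all poles of [f] and all radii of the
   coefficients. The margin lets [f] be holomorphic already from [rho - 1], so each point with $|z|
   \ge \rho$ has a unit disc for the higher derivatives. *)
clear psE; pose rho := 2 + Sp + Sb + SP; have rho1 : 1 <= rho by rewrite /rho; lra.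
exists (rho + 1); first by lra.
have fd z : rho - 1 <= cabs z -> cdiff f z (derive1 f z).
  move=> hz; case: (fm z) => [/holomorphic_atP [e e0 H]|/pole_small].
    by apply: H; rewrite subrr cabs0.
  by move: hz; rewrite /rho; lra.
apply: (@solution_growth _ n s f b (fun z => \sum_(j < 3) P j z * cexp (gamma j).[z])) => //.
- move=> i z hz; apply: (@cdiff_derive1n _ f z 1) => [w wz|]; last by rewrite subrr cabs0.
  by apply: fd; have := cabs_revB z w; rewrite cabsB; lra.
- move=> z hz; apply: feq.
  + by move=> /pole_small; move: hz; rewrite /rho; lra.
  + by move=> i; case: (rbP i) => _ H _; apply: H; have := rbS i; move: hz; rewrite /rho; lra.
  + by move=> j; case: (rPP j) => _ H _; apply: H; have := rPS j; move: hz; rewrite /rho; lra.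
- move=> i; case: (rbP i) => _ _; apply: dominated_le; have := rbS i; rewrite /rho; lra.
- apply: dominated_sum => j; apply: dominatedM.
    by case: (rPP j) => _ _; apply: dominated_le; have := rPS j; rewrite /rho; lra.
  exact: dominated_le rho1 (dominated_cexp _).
Qed.

End ExponentialForm.

Theorem theorem6 (R : realType) (n s : nat)
    (b : 'I_s.+1 -> R[i] -> R[i])
    (P : 'I_3 -> R[i] -> R[i]) (gamma : 'I_3 -> {poly R[i]})
    (f : R[i] -> R[i]) :
  (3 <= n)%N ->
  (forall i, rational_function (b i)) ->
  (forall j, rational_function (P j)) ->
  (forall j, P j <> (fun=> 0)) ->
  (forall j, (1 < size (gamma j))%N) ->
  injective (fun j => deriv (gamma j)) ->
  meromorphic f ->
  transcendental f ->
  (forall z : R[i],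
     ~ pole f z -> (forall i, ~ pole (b i) z) -> (forall j, ~ pole (P j) z) ->
     f z ^+ n * derive1 f z + lin_diff_poly b f z
       = \sum_(j < 3) P j z * cexp (gamma j).[z]) ->
  finite_set [set z | pole f z] ->
  finite_order f /\
  ~ exists (w : R[i] -> R[i]) (t : {poly R[i]}),
      [/\ rational_function w, w <> (fun=> 0), (1 < size t)%N &
          mero_eq f (fun z => w z * cexp t.[z])].
Proof.
move=> n3 br Pr P0 _ inj fm _ feq fp; split.
  have [rho rho1 fdom] := solution_dominated n3 br Pr fm feq fp.
  exact: finite_order_of_dominated rho1 fdom fp.
move=> [w [t [wr _ _]]].
exact: no_exponential_form br Pr P0 inj feq fp wr.
Qed.
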